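(* Fix the dimension $d$ as a constant. Given a convex polytope $\Omega \subset \mathbb{R}^d$ (with nonempty interior) and $\varepsilon > 0$, there exists a data structure that, for any query point $x \in \Omega$, returns a value $\widetilde{d}(x)$ with $|\widetilde{d}(x) - d_{\Omega}(x)| \leq \varepsilon \cdot \mathrm{diam}(\Omega)$ (with no continuity guarantee on $\widetilde{d}$), with query time $O(\log(1/\varepsilon))$ and storage $O(1/\varepsilon^{d/2})$.
   Context: $d_{\Omega}(x) = \inf_{y \in \partial\Omega}\|x - y\|$ is the Euclidean distance from $x \in \Omega$ to the boundary $\partial\Omega$, and $\mathrm{diam}(\Omega)$ is the diameter of $\Omega$. The hidden constants in the $O$-notation depend only on $d$. *)

(* Defs.v *)
From HB Require Import structures.
From mathcomp Require Import all_boot all_order all_algebra.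
From mathcomp Require Import all_classical all_reals all_analysis.
Set Implicit Arguments. Unset Strict Implicit. Unset Printing Implicit Defensive.
Import Order.TTheory GRing.Theory Num.Theory.
Local Open Scope classical_set_scope.
Local Open Scope ring_scope.

(* Euclidean norm (the library's norm on 'rV is the sup norm, so we define it). *)
Definition enorm (R : realType) (d : nat) (x : 'rV[R]_d) : R :=
  Num.sqrt (\sum_(i < d) (x ord0 i) ^+ 2).

Definition polytope (R : realType) (d : nat) (V : seq 'rV[R]_d) : set 'rV[R]_d :=
  [set x | exists w : 'I_(size V) -> R,
     (forall i, 0 <= w i) /\ \sum_(i < size V) w i = 1 /\
     x = \sum_(i < size V) w i *: nth 0 V i].

Definition interior_pts (R : realType) (d : nat) (A : set 'rV[R]_d) : set 'rV[R]_d :=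
  [set x | exists r : R, 0 < r /\ forall y, enorm (y - x) < r -> A y].

(* Boundary of a closed set A (polytopes are closed): A minus its interior. *)
Definition boundary (R : realType) (d : nat) (A : set 'rV[R]_d) : set 'rV[R]_d :=
  [set x | A x /\ ~ interior_pts A x].

Definition dist_boundary (R : realType) (d : nat) (A : set 'rV[R]_d)
  (x : 'rV[R]_d) : R :=
  inf [set r | exists y, boundary A y /\ r = enorm (x - y)].

Definition diam (R : realType) (d : nat) (A : set 'rV[R]_d) : R :=
  sup [set r | exists x y, A x /\ A y /\ r = enorm (x - y)].

(* ---------- Model of computation: real-RAM branching program ----------
   A data structure is a finite program (a control-flow graph) whose nodes
   are stored instructions; real constants are stored in IConst nodes.
   Storage = number of nodes; query time = number of executed instructions.
   Registers are write-once: each non-branching instruction appends a value. *)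
Inductive instr (R : realType) (d : nat) : Type :=
| IConst  (c : R) (nxt : nat)
| IInput  (i : 'I_d) (nxt : nat)
| IAdd    (j k : nat) (nxt : nat)
| ISub    (j k : nat) (nxt : nat)
| IMul    (j k : nat) (nxt : nat)
| IDiv    (j k : nat) (nxt : nat)
| ISqrt   (j : nat) (nxt : nat)
| IBranch (j : nat) (nxt_nonneg nxt_neg : nat)
| IOutput (j : nat).

Fixpoint run (R : realType) (d : nat) (prog : seq (instr R d)) (fuel : nat)
  (pc : nat) (regs : seq R) (x : 'rV[R]_d) : option R :=
  match fuel with
  | 0%N => None
  | fuel'.+1 =>
    if (pc < size prog)%N then
      let rg j := nth 0 regs j in
      match nth (IOutput R d 0) prog pc with
      | IConst c n => run prog fuel' n (rcons regs c) x
      | IInput i n => run prog fuel' n (rcons regs (x ord0 i)) x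
      | IAdd j k n => run prog fuel' n (rcons regs (rg j + rg k)) x
      | ISub j k n => run prog fuel' n (rcons regs (rg j - rg k)) x
      | IMul j k n => run prog fuel' n (rcons regs (rg j * rg k)) x
      | IDiv j k n => run prog fuel' n (rcons regs (rg j / rg k)) x
      | ISqrt j n => run prog fuel' n (rcons regs (Num.sqrt (rg j))) x
      | IBranch j n1 n2 =>
          if 0 <= rg j then run prog fuel' n1 regs x else run prog fuel' n2 regs x
      | IOutput j => Some (rg j)
      end
    else None
  end.

Definition query (R : realType) (d : nat) (prog : seq (instr R d)) (T : nat)
  (x : 'rV[R]_d) : option R := run prog T 0 [::] x.

(* Main.v *)
(* On the polytope W, - d_W is convex and 1-Lipschitz, and infimal convolution with the norm
   extends it to such a function f on R^d (normalised so that W lies in the unit ball).  Put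
   g = f + |.|^2 / 2 and, for a scale s = 2^-l, let N_s(x) be the symmetric convex body of
   the v with g (x + v) + g (x - v) - 2 g x <= s^2 (a projected Macbeath region).  Bodies
   whose centres lie in one another are comparable, f is affine up to s^2 on x + N_s(x) / 2,
   and each body is equivalent to a parallelepiped, hence membership is tested in O(1) time.

   A maximal set of points, none in a small multiple of an earlier body, has size O(s^-d).
   Indeed each x has a slope P that makes x central in the section
   {y | g y <= g x + P (y - x) + s^2}; strong convexity of g forces the slopes of two points
   that are not in comparable bodies to be c s apart, so a grid on the bounded set of slopes
   yields the count.

   The query walks through these nets, from s = 1 down to s = sqrt eps.  Each body meets
   O(1) bodies of the next scale, so a node has O(1) successors and the sizes of the levels
   add up geometrically to O(eps^(-d/2)). *)
Require Import Defs.
From HB Require Import structures.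
From mathcomp Require Import all_boot all_order all_algebra.
From mathcomp Require Import all_classical all_reals all_analysis.
From mathcomp Require Import perm ring lra zify.
Import Order.TTheory GRing.Theory Num.Theory.
Local Open Scope classical_set_scope.
Local Open Scope ring_scope.
Set Implicit Arguments. Unset Strict Implicit. Unset Printing Implicit Defensive.

(** * Convex functions and subgradients *)

Definition convexf (R : realType) (V : lmodType R) (g : V -> R) :=
  forall t x y, 0 <= t -> t <= 1 ->
    g (t *: x + (1 - t) *: y) <= t * g x + (1 - t) * g y.

Definition dot (R : realType) (d : nat) (p v : 'rV[R]_d) : R :=
  \sum_(i < d) p ord0 i * v ord0 i.

Section Dot.
Variables (R : realType) (d : nat).
Implicit Types (p q v w : 'rV[R]_d).

Lemma dotDr p v w : dot p (v + w) = dot p v + dot p w.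
Proof. by rewrite -big_split; apply: eq_bigr => i _; rewrite mxE mulrDr. Qed.

Lemma dotZr p a v : dot p (a *: v) = a * dot p v.
Proof. by rewrite mulr_sumr; apply: eq_bigr => i _; rewrite mxE mulrCA. Qed.

Lemma dotC p v : dot p v = dot v p.
Proof. by apply: eq_bigr => i _; rewrite mulrC. Qed.

Lemma dotZl p a v : dot (a *: p) v = a * dot p v.
Proof. by rewrite dotC dotZr dotC. Qed.

Lemma dotNr p v : dot p (- v) = - dot p v.
Proof. by rewrite -scaleN1r dotZr mulN1r. Qed.

Lemma dot0r p : dot p 0 = 0.
Proof. by rewrite -(scale0r p) dotZr mul0r. Qed.

Lemma dotBr p v w : dot p (v - w) = dot p v - dot p w.
Proof. by rewrite dotDr dotNr. Qed.

Lemma dotDl p q v : dot (p + q) v = dot p v + dot q v.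
Proof. by rewrite dotC dotDr !(dotC v). Qed.

Lemma dotBl p q v : dot (p - q) v = dot p v - dot q v.
Proof. by rewrite dotC dotBr !(dotC v). Qed.

Lemma dot_delta p k : dot p (delta_mx ord0 k) = p ord0 k.
Proof.
rewrite /dot (bigD1 k) //= mxE !eqxx mulr1 big1 ?addr0 // => i ik.
by rewrite mxE (negbTE ik) andbF mulr0.
Qed.

End Dot.

Section Subgradient.
Variables (R : realType) (d : nat) (F : 'rV[R]_d -> R).
Hypothesis cF : convexf F.
Implicit Types (p q v w : 'rV[R]_d).

(* One-step Hahn-Banach extension. *)
Lemma subgradient_step (k : 'I_d) (p : 'rV[R]_d) :
  (forall v, (forall i : 'I_d, (k <= i)%N -> v ord0 i = 0) -> F 0 + dot p v <= F v) ->
  exists q : 'rV[R]_d, forall v, (forall i : 'I_d, (k < i)%N -> v ord0 i = 0) ->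
    F 0 + dot q v <= F v.
Proof.
move=> hp.
pose W (w : 'rV[R]_d) := forall i : 'I_d, (k <= i)%N -> w ord0 i = 0.
pose e : 'rV[R]_d := delta_mx ord0 k.
(* Every slope towards [- e] is at most every slope towards [e]; a number between the two families
   extends [p] by one coordinate. *)
have key w w' s t : W w -> W w' -> 0 < s -> 0 < t ->
    (F 0 + dot p w' - F (w' - s *: e)) / s <= (F (w + t *: e) - F 0 - dot p w) / t.
  move=> Ww Ww' s0 t0.
  have st : 0 < s + t by lra.
  pose a := t / (s + t).
  have a1 : 1 - a = s / (s + t) by rewrite /a; field; lra.
  have a0 : 0 <= a by rewrite divr_ge0 // ltW.
  have a01 : a <= 1 by rewrite -subr_ge0 a1 divr_ge0 // ltW.
  have := cF (w' - s *: e) (w + t *: e) a0 a01.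
  have -> : a *: (w' - s *: e) + (1 - a) *: (w + t *: e) = a *: w' + (1 - a) *: w.
    by apply/rowP => i; rewrite !mxE a1 /a; field; lra.
  have Wm : W (a *: w' + (1 - a) *: w).
    by move=> i ki; rewrite !mxE Ww // Ww' // !mulr0 addr0.
  move: (hp _ Wm); rewrite dotDr !dotZr a1 => h1 h2.
  rewrite ler_pdivrMr // mulrAC ler_pdivlMr //.
  have h3 := le_trans h1 h2.
  have := ler_wpM2l (ltW st) h3.
  have -> : (s + t) * (F 0 + (a * dot p w' + s / (s + t) * dot p w)) =
    (s + t) * F 0 + t * dot p w' + s * dot p w by rewrite /a; field; lra.
  have -> : (s + t) * (a * F (w' - s *: e) + s / (s + t) * F (w + t *: e)) =
    t * F (w' - s *: e) + s * F (w + t *: e) by rewrite /a; field; lra.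
  lra.
pose A := [set r : R | exists w s, [/\ W w, 0 < s & r = (F 0 + dot p w - F (w - s *: e)) / s]].
have W0 : W 0 by move=> i _; rewrite mxE.
have Aub w t : W w -> 0 < t -> ubound A ((F (w + t *: e) - F 0 - dot p w) / t).
  by move=> Ww t0 r [w' [s [Ww' s0 ->]]]; exact: key.
have A0 : A !=set0 by exists ((F 0 + dot p 0 - F (0 - 1 *: e)) / 1); exists 0, 1.
have hA : has_sup A by split => //; exists ((F (0 + 1 *: e) - F 0 - dot p 0) / 1); exact: Aub.
pose a := sup A.
exists (\row_i if i == k then a else p ord0 i) => v hv.
pose w : 'rV[R]_d := \row_i if i == k then 0 else v ord0 i.
have Ww : W w.
  move=> i ki; rewrite mxE; case: eqVneq => // ik.
  by apply: hv; rewrite ltn_neqAle ki andbT; apply: contra ik => /eqP /val_inj ->.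
have vE : v = w + v ord0 k *: e.
  apply/rowP => i; rewrite !mxE eqxx /=; case: eqVneq => [->|_].
    by rewrite mulr1 add0r.
  by rewrite mulr0 addr0.
set t := v ord0 k in vE.
have -> : dot (\row_i (if i == k then a else p ord0 i)) v = dot p w + t * a.
  rewrite {1}vE dotDr dotZr dot_delta mxE eqxx; congr (_ + _).
  by apply: eq_bigr => i _; rewrite !mxE; case: eqVneq => // _; rewrite !mulr0.
rewrite vE.
have [t0|t0|->] := ltgtP t 0.
- have : A ((F 0 + dot p w - F (w - (- t) *: e)) / (- t)).
    by exists w, (- t); split => //; lra.
  move/(sup_upper_bound hA); rewrite -/a ler_pdivrMr; last lra.
  rewrite scaleNr opprK; lra.
- have : a <= (F (w + t *: e) - F 0 - dot p w) / t.
    by apply: ge_sup => //; exact: Aub.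
  rewrite ler_pdivlMr //; lra.
- by rewrite mul0r addr0 scale0r addr0 hp.
Qed.

Lemma subgradient0 : exists p : 'rV[R]_d, forall v, F 0 + dot p v <= F v.
Proof.
(* Induction on the number of leading coordinates that [v] may use. *)
suff H k : (k <= d)%N -> exists p : 'rV[R]_d, forall v,
    (forall i : 'I_d, (k <= i)%N -> v ord0 i = 0) -> F 0 + dot p v <= F v.
  have [p hp] := H d (leqnn d).
  by exists p => v; apply: hp => i; rewrite leqNgt ltn_ord.
elim: k => [_|k IH kd].
  exists 0 => v hv; have -> : v = 0 by apply/rowP => i; rewrite mxE hv.
  by rewrite dot0r addr0.
have [p hp] := IH (ltnW kd).
by have [q hq] := @subgradient_step (Ordinal kd) p hp; exists q.
Qed.

End Subgradient.

Lemma convexf_shift (R : realType) (d : nat) (g : 'rV[R]_d -> R) x :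
  convexf g -> convexf (fun v => g (x + v)).
Proof.
move=> cg t v w t0 t1; have := cg t (x + v) (x + w) t0 t1; congr (g _ <= _).
by apply/rowP => i; rewrite !mxE; ring.
Qed.

Lemma subgradient (R : realType) (d : nat) (g : 'rV[R]_d -> R) x :
  convexf g -> exists p : 'rV[R]_d, forall v, g x + dot p v <= g (x + v).
Proof. by move=> /(convexf_shift x) /subgradient0[p]; rewrite addr0; exists p. Qed.

(** The rows of [M] come within a factor 2 of the supremum of [|\det M|] over rows in [N]. By
    Cramer's rule a coordinate of [v] is the ratio of the determinants after and before one row is
    replaced by [v], so it is at most 2. A near maximiser, unlike a maximiser, comes from the
    supremum alone. *)
Lemma approx_auerbach (R : realType) (d : nat) (N : set 'rV[R]_d) (B r : R) :
  0 < r -> (forall v, N v -> forall i, `|v ord0 i| <= B) ->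
  (forall k, N (r *: delta_mx ord0 k)) ->
  exists M : 'M[R]_d, [/\ M \in unitmx, forall k, N (row k M) &
    forall v k, N v -> `|(v *m invmx M) ord0 k| <= 2].
Proof.
move=> r0 NB Nr.
pose S := [set t : R | exists M : 'M[R]_d, (forall k, N (row k M)) /\ t = `|\det M|].
have ubS : ubound S (\sum_(s : 'S_d) \prod_(i < d) B).
  move=> t [M [NM ->]]; apply: le_trans (ler_norm_sum _ _ _) _.
  apply: ler_sum => s _; rewrite normrM normrX normrN1 expr1n mul1r normr_prod.
  apply: ler_prod => i _; rewrite normr_ge0 /=.
  by have := NB _ (NM i) (s i); rewrite mxE.
(* The scaled unit vectors make the supremum positive, so the near maximiser is invertible. *)
have Srd : S (r ^+ d).
  exists (r%:M); split; last by rewrite det_scalar ger0_norm // exprn_ge0 // ltW.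
  by move=> k; rewrite rowE scalar_mxC mul_scalar_mx.
have hS : has_sup S by split; [exists (r ^+ d)|exists (\sum_(s : 'S_d) \prod_(i < d) B)].
have supS0 : 0 < sup S.
  by apply: lt_le_trans (sup_upper_bound hS Srd); rewrite exprn_gt0.
have [t [M [NM ->]] ltM] := sup_adherent (divr_gt0 supS0 (ltr0Sn _ 1)) hS.
have detM0 : 0 < `|\det M| by lra.
have uM : M \in unitmx by rewrite unitmxE unitfE -normr_gt0.
exists M; split=> // v k Nv.
pose M' := \matrix_(i < d) if i == k then v else row i M.
have SM' : S `|\det M'|.
  exists M'; split=> // i; rewrite rowK; by case: eqP.
have -> : (v *m invmx M) ord0 k = \det M' / \det M.
  rewrite /invmx uM -scalemxAr mxE mulrC (expand_det_row M' k); congr (_ / _).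
  rewrite mxE; apply: eq_bigr => j _; rewrite !mxE eqxx; congr (_ * _).
  rewrite /cofactor; congr (_ * \det _).
  by apply/matrixP => a b; rewrite !mxE eq_sym (negbTE (neq_lift _ _)) mxE.
rewrite normrM normfV ler_pdivrMr //.
by have := sup_upper_bound hS SM'; lra.
Qed.

(** * Symmetric second differences of a convex function *)

Definition secdiff (R : realType) (V : lmodType R) (g : V -> R) (x v : V) : R :=
  g (x + v) + g (x - v) - 2 * g x.

Section Secdiff.
Variables (R : realType) (V : lmodType R) (g : V -> R).
Hypothesis cg : convexf g.
Implicit Types (x y u v w : V) (t : R).

Lemma convexf_mid x y : g (2^-1 *: (x + y)) <= (g x + g y) / 2.
Proof.
have h1 : (0 : R) <= 2^-1 by lra.
have h2 : (2^-1 : R) <= 1 by lra.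
have := cg x y h1 h2; have -> : 1 - 2^-1 = 2^-1 :> R by field.
rewrite -scalerDr; lra.
Qed.

Lemma secdiffN x v : secdiff g x (- v) = secdiff g x v.
Proof. by rewrite /secdiff opprK [g (x - v) + _]addrC. Qed.

Lemma halfDr x : 2^-1 *: (x + x) = x.
Proof. by rewrite scalerDr -scalerDl (_ : 2^-1 + 2^-1 = 1) ?scale1r //; field. Qed.

Lemma secdiff_ge0 x v : 0 <= secdiff g x v.
Proof.
have := convexf_mid (x + v) (x - v).
by rewrite addrACA subrr addr0 halfDr /secdiff; lra.
Qed.

Lemma secdiffZ x v t : 0 <= t -> t <= 1 -> secdiff g x (t *: v) <= t * secdiff g x v.
Proof.
move=> t0 t1; rewrite /secdiff.
have e1 w : x + t *: w = t *: (x + w) + (1 - t) *: x.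
  by rewrite scalerDr scalerBl scale1r addrAC addrCA subrr addr0.
have := cg (x + v) x t0 t1; have := cg (x - v) x t0 t1.
by rewrite -!e1 scalerN; lra.
Qed.

Lemma secdiff_half x u : secdiff g x u <= secdiff g x (2 *: u) / 2.
Proof.
have := @secdiffZ x (2 *: u) 2^-1; rewrite scalerA mulVf ?pnatr_eq0 // scale1r.
by move=> /(_ ltac:(lra) ltac:(lra)); lra.
Qed.

(* The next three inequalities make the bodies {v | secdiff g x v <= c} at nearby
   base points comparable, without any regularity of g. *)
Lemma secdiff_shift_self x u : secdiff g (x + u) u <= secdiff g x (2 *: u).
Proof.
have := convexf_mid x (x - 2 *: u).
have -> : 2^-1 *: (x + (x - 2 *: u)) = x - u.
  by rewrite addrA scalerBr halfDr scalerA mulVf ?pnatr_eq0 // scale1r.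
rewrite /secdiff; have -> : x + u + u = x + 2 *: u by rewrite scaler_nat mulr2n addrA.
rewrite addrK.
have := secdiff_ge0 x u; rewrite /secdiff; lra.
Qed.

Lemma secdiff_shift x u w :
  secdiff g (x + u) (2^-1 *: w) <= secdiff g x (2 *: u) + secdiff g x w / 2.
Proof.
have := secdiff_shift_self x u.
rewrite {1 2}/secdiff addrK.
have -> : x + u + u = x + 2 *: u by rewrite scaler_nat mulr2n addrA.
have e w' : x + u + 2^-1 *: w' = 2^-1 *: ((x + 2 *: u) + (x + w')).
  by rewrite addrACA !scalerDr scalerA mulVf ?pnatr_eq0 // scale1r addrA
    -scalerDr halfDr.
have := convexf_mid (x + 2 *: u) (x + w); have := convexf_mid (x + 2 *: u) (x - w).
by rewrite -!e scalerN /secdiff; lra.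
Qed.

Lemma secdiff_unshift x u w :
  secdiff g x (2^-1 *: w) <= secdiff g (x + u) w / 2 + secdiff g x u.
Proof.
have e w' : x + 2^-1 *: w' = 2^-1 *: ((x + u + w') + (x - u)).
  have -> : x + u + w' + (x - u) = (x + x) + w'.
    by rewrite (addrAC x u) addrACA subrr addr0 addrAC.
  by rewrite scalerDr halfDr.
have := convexf_mid (x + u + w) (x - u); have := convexf_mid (x + u - w) (x - u).
by rewrite -!e scalerN /secdiff; lra.
Qed.

End Secdiff.

(** * Central slopes *)

(** Partial minimisation over a convex relation. It gives both the minorant behind [central_slope]
    and the infimal convolution in [dist_extension]. *)
Lemma convexf_inf (R : realType) (V : lmodType R) (J : V -> R -> Prop) :
  (forall v, exists a, J v a) -> (forall v, has_lbound [set a | J v a]) ->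
  (forall t v w a b, 0 <= t -> t <= 1 -> J v a -> J w b ->
     J (t *: v + (1 - t) *: w) (t * a + (1 - t) * b)) ->
  convexf (fun v => inf [set a | J v a]).
Proof.
move=> J0 Jlb Jc t v w t0 t1.
have hJ u : has_inf [set a | J u a] by split; [have [a] := J0 u; exists a|].
apply/ler_addgt0Pr => e e0.
have [a Ja av] := inf_adherent e0 (hJ v).
have [b Jb bw] := inf_adherent e0 (hJ w).
apply: le_trans (ge_inf (Jlb _) (Jc _ _ _ _ _ t0 t1 Ja Jb)) _.
have : t * a <= t * (inf [set a | J v a] + e) by rewrite ler_wpM2l // ltW.
have : (1 - t) * b <= (1 - t) * (inf [set a | J w a] + e).
  by rewrite ler_wpM2l ?subr_ge0 // ltW.
lra.
Qed.

Section Tilt.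
Variables (R : realType) (d : nat) (g : 'rV[R]_d -> R).
Hypotheses (d0 : (0 < d)%N) (cg : convexf g).
Variables (x : 'rV[R]_d) (c : R) (T : 'M[R]_d).
Hypotheses (c0 : 0 < c)
  (hT : forall v k, secdiff g x v <= c -> `|(v *m T) ord0 k| <= 2).
Implicit Types (p q v w : 'rV[R]_d).

Let sT (G : 'I_d * bool) v : R := (-1) ^+ G.2 * (v *m T) ord0 G.1.

Let sTD G a b v w : sT G (a *: v + b *: w) = a * sT G v + b * sT G w.
Proof. by rewrite /sT mulmxDl -!scalemxAl !mxE; ring. Qed.

(* A slope for which x is deep inside the section {v | g (x + v) <= g x + dot P v + c}.
   P is a subgradient at 0 of a convex minorant of g raised by 2c near x.  The minorant
   is the lower boundary of J, whose members split v into pieces w G, one for each of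
   the 2d far regions {v | sT G v >= 16d}; a heavy piece w G has sT G (w G) >= 4, so
   w G and - w G cannot both be cheap. *)
Lemma central_slope : exists P : 'rV[R]_d, forall v,
  - c <= g (x + v) - g x - dot P v /\
  ((exists k, 16 * d%:R <= `|(v *m T) ord0 k|) -> c <= g (x + v) - g x - dot P v).
Proof.
have cgx := convexf_shift x cg.
have [q hq] := subgradient x cg.
pose gt v := g (x + v) - g x - dot q v.
have gt_ge0 v : 0 <= gt v by have := hq v; rewrite /gt; lra.
have gt0 : gt 0 = 0 by rewrite /gt addr0 dot0r; ring.
have cgt : convexf gt.
  move=> t v w t0 t1; have := cgx t v w t0 t1.
  by rewrite /gt dotDr !dotZr; lra.
have gtN w : gt w + gt (- w) = secdiff g x w.
  by rewrite /gt dotNr /secdiff; ring.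
(* [mu G] homogenises the condition of being far in direction [G], which keeps the relation jointly
   convex; [mu0] is the weight that pays the raise [2 * c]. *)
pose J v (a : R) := exists (w : 'I_d * bool -> 'rV[R]_d) (mu : 'I_d * bool -> R) (mu0 : R),
  [/\ forall G, 0 <= mu G, \sum_G mu G + mu0 = 1,
      forall G, 16 * d%:R * mu G <= sT G (w G),
      forall G, gt (w G) + gt (v - w G) <= a & 0 <= mu0 /\ 2 * c * mu0 <= a].
have Jin v : J v (gt v + 2 * c).
  exists (fun=> 0), (fun=> 0), 1; split => //.
  - by rewrite big1 // add0r.
  - by move=> G; rewrite /sT mul0mx mxE !mulr0.
  - by move=> G; rewrite gt0 subr0 add0r lerDl mulr_ge0 // ltW.
  - by split => //; have := gt_ge0 v; lra.
have Jout v : (exists k, 16 * d%:R <= `|(v *m T) ord0 k|) -> J v (gt v).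
  move=> [k hk]; pose G0 : 'I_d * bool := (k, (v *m T) ord0 k < 0).
  exists (fun G => if G == G0 then v else 0), (fun G => if G == G0 then 1 else 0), 0; split.
  - by move=> G; case: eqP.
  - by rewrite -big_mkcond big_pred1_eq addr0.
  - move=> G; case: eqVneq => [->|_]; last by rewrite /sT mul0mx mxE !mulr0.
    rewrite mulr1 (le_trans hk) // /sT /G0 /=.
    by case: ltP => h /=; [rewrite expr1 mulN1r ltr0_norm|rewrite expr0 mul1r ger0_norm].
  - move=> G; case: eqP => _; first by rewrite subrr gt0 addr0.
    by rewrite subr0 gt0 add0r.
  - by rewrite mulr0.
have Jge0 v a : J v a -> 0 <= a.
  by move=> [w [mu [mu0 [_ _ _ _ [h1 h2]]]]]; apply: le_trans h2; rewrite !mulr_ge0 // ltW.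
(* A value below [c] would force [mu0] below 1/2 and, by [hT] applied to [w G], each of the [2 * d]
   weights [mu G] below [1 / (4 * d)]; the total would stay below 1. *)
have J0 a : J 0 a -> c <= a.
  move=> [w [mu [mu0 [mu_ge0 sum_mu hw ha [h1 h2]]]]].
  rewrite leNgt; apply/negP => ac.
  have mu0lt : mu0 < 2^-1.
    rewrite -(ltr_pM2l c0); lra.
  have d0' : (0 : R) < d%:R by rewrite ltr0n.
  have hmu G : mu G < (4 * d%:R)^-1.
    rewrite -(@ltr_pM2l _ (16 * d%:R)); last by lra.
    have -> : 16 * d%:R * (4 * d%:R)^-1 = 4 :> R by field; lra.
    apply: le_lt_trans (hw G) _.
    have : secdiff g x (w G) <= c.
      by rewrite -gtN; have := ha G; rewrite sub0r; lra.
    move=> /hT => /(_ G.1) h.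
    have : sT G (w G) <= 2.
      apply: le_trans h; rewrite /sT -signr_odd; case: (odd _).
        by rewrite expr1 mulN1r -normrN ler_norm.
      by rewrite expr0 mul1r ler_norm.
    lra.
  have : \sum_G mu G <= \sum_(G : 'I_d * bool) (4 * d%:R)^-1.
    by apply: ler_sum => G _; exact: ltW.
  rewrite sumr_const card_prod card_ord card_bool -[_ *+ (d * 2)]mulr_natr natrM.
  have -> : (4 * d%:R)^-1 * (d%:R * 2) = 2^-1 :> R by field; lra.
  lra.
have cghat : convexf (fun v => inf [set a | J v a]).
  apply: convexf_inf.
  - by move=> v; exists (gt v + 2 * c).
  - by move=> v; exists 0 => a; exact: Jge0.
  move=> t v1 v2 a1 a2 t0 t1 [w1 [mu1 [mu01 [m1 s1 c1 b1 [n1 e1]]]]]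
    [w2 [mu2 [mu02 [m2 s2 c2 b2 [n2 e2]]]]].
  have t1' : 0 <= 1 - t by rewrite subr_ge0.
  exists (fun G => t *: w1 G + (1 - t) *: w2 G), (fun G => t * mu1 G + (1 - t) * mu2 G),
    (t * mu01 + (1 - t) * mu02); split.
  - by move=> G; rewrite addr_ge0 // mulr_ge0.
  - rewrite big_split /= -!mulr_sumr.
    have -> : \sum_i mu1 i = 1 - mu01 by lra.
    have -> : \sum_i mu2 i = 1 - mu02 by lra.
    by ring.
  - move=> G; rewrite sTD.
    have := ler_wpM2l t0 (c1 G); have := ler_wpM2l t1' (c2 G); lra.
  - move=> G.
    have -> : t *: v1 + (1 - t) *: v2 - (t *: w1 G + (1 - t) *: w2 G) =
      t *: (v1 - w1 G) + (1 - t) *: (v2 - w2 G).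
      by apply/rowP => i; rewrite !mxE; ring.
    have := cgt _ (w1 G) (w2 G) t0 t1; have := cgt _ (v1 - w1 G) (v2 - w2 G) t0 t1.
    have := ler_wpM2l t0 (b1 G); have := ler_wpM2l t1' (b2 G); lra.
  - split; first by rewrite addr_ge0 // mulr_ge0.
    have := ler_wpM2l t0 e1; have := ler_wpM2l t1' e2; lra.
have [p hp] := subgradient0 cghat.
have ghat0 : c <= inf [set a | J 0 a].
  by apply: lb_le_inf; [exists (gt 0 + 2 * c); exact: Jin|exact: J0].
exists (q + p) => v; rewrite dotDl.
have key a : J v a -> c + dot p v <= a.
  move=> Ja; apply: le_trans (_ : inf [set a | J v a] <= _).
    by apply: le_trans (hp v); rewrite lerD2r.
  by apply: ge_inf => //; exists 0 => b; exact: Jge0.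
split; first by have := key _ (Jin v); rewrite /gt; lra.
by move=> /Jout /key; rewrite /gt; lra.
Qed.

End Tilt.

(** * Packing bounds *)

Section Enorm.
Variables (R : realType) (d : nat).
Implicit Types (p q v w x y : 'rV[R]_d).

Lemma sqr_enorm x : enorm x ^+ 2 = dot x x.
Proof.
rewrite /enorm sqr_sqrtr; first by apply: eq_bigr => i _; rewrite expr2.
by apply: sumr_ge0 => i _; exact: sqr_ge0.
Qed.

Lemma enorm_ge0 x : 0 <= enorm x. Proof. exact: sqrtr_ge0. Qed.

Lemma dot_ge0 x : 0 <= dot x x. Proof. by rewrite -sqr_enorm sqr_ge0. Qed.

Lemma enormZ a x : enorm (a *: x) = `|a| * enorm x.
Proof.
apply/eqP; rewrite -(@eqrXn2 _ 2) ?mulr_ge0 ?enorm_ge0 //.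
by rewrite exprMn !sqr_enorm real_normK ?num_real // dotZr dotC dotZr; apply/eqP; ring.
Qed.

Lemma enorm_delta k : enorm (delta_mx ord0 k : 'rV[R]_d) = 1.
Proof.
apply/eqP; rewrite -(@eqrXn2 _ 2) ?enorm_ge0 // sqr_enorm dot_delta mxE !eqxx.
by rewrite expr1n.
Qed.

Lemma enormN x : enorm (- x) = enorm x.
Proof. by rewrite -scaleN1r enormZ normrN1 mul1r. Qed.

Lemma enormB x y : enorm (x - y) = enorm (y - x).
Proof. by rewrite -enormN opprB. Qed.

Lemma enorm0 : enorm (0 : 'rV[R]_d) = 0.
Proof. by rewrite -(scale0r 0) enormZ normr0 mul0r. Qed.

Lemma coord_le_enorm x i : `|x ord0 i| <= enorm x.
Proof.
rewrite -(@ler_pXn2r _ 2) ?nnegrE ?enorm_ge0 // sqr_enorm real_normK ?num_real //.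
rewrite /dot (bigD1 i) //= -expr2 lerDl; apply: sumr_ge0 => j _.
by rewrite -expr2 sqr_ge0.
Qed.

Lemma enorm_eq0 x : enorm x = 0 -> x = 0.
Proof.
move=> x0; apply/rowP => i; rewrite mxE; apply/eqP.
by rewrite -normr_eq0 eq_le normr_ge0 andbT -x0 coord_le_enorm.
Qed.

Lemma dot_le x y : dot x y <= enorm x * enorm y.
Proof.
have [y0|y0] := eqVneq (enorm y) 0.
  by rewrite y0 (enorm_eq0 y0) dot0r mulr0.
have y0' : 0 < enorm y by rewrite lt_neqAle eq_sym y0 enorm_ge0.
apply: le_trans (ler_norm _) _.
rewrite -(@ler_pXn2r _ 2) ?nnegrE ?mulr_ge0 ?enorm_ge0 //.
rewrite exprMn !sqr_enorm real_normK ?num_real //.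
have := dot_ge0 (dot y y *: x - dot x y *: y).
rewrite dotBl !dotBr !dotZl !dotZr (dotC y x) => h.
have yy : 0 < dot y y by rewrite -sqr_enorm exprn_gt0.
rewrite -subr_ge0 -(pmulr_rge0 _ yy); move: h; congr (0 <= _); ring.
Qed.

Lemma enormD x y : enorm (x + y) <= enorm x + enorm y.
Proof.
rewrite -(@ler_pXn2r _ 2) ?nnegrE ?addr_ge0 ?enorm_ge0 // sqrrD !sqr_enorm.
rewrite dotDl !dotDr (dotC y x); have := dot_le x y; lra.
Qed.

Lemma enorm_le_coord x (e : R) : (forall i, `|x ord0 i| <= e) -> enorm x <= d%:R * e.
Proof.
move=> xe; have [k _|noI] := pickP 'I_d; last first.
  have -> : x = 0 by apply/rowP => i; have := noI i.
  rewrite enorm0; case: (posnP d) => [->|d0]; first by rewrite mul0r.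
  by have := noI (Ordinal d0).
have e0 : 0 <= e by apply: le_trans (xe k).
have d1 : (1 : R) <= d%:R by rewrite ler1n (leq_ltn_trans _ (ltn_ord k)).
rewrite -(@ler_pXn2r _ 2) ?nnegrE ?mulr_ge0 ?enorm_ge0 // sqr_enorm.
apply: le_trans (_ : \sum_(i < d) e ^+ 2 <= _).
  apply: ler_sum => i _; rewrite -expr2 -real_normK ?num_real //.
  by rewrite ler_pXn2r ?nnegrE.
rewrite sumr_const card_ord -[_ *+ d]mulr_natl exprMn ler_wpM2r ?sqr_ge0 //.
by rewrite expr2 ler_peMl //; lra.
Qed.

End Enorm.

Section Pigeonhole.
Variables (R : realType) (d : nat).
Implicit Types (B e : R) (v w : 'rV[R]_d).

(** For [0 < e] and coordinates of absolute value at most [B], the index is already in range and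
    [inord] keeps it. *)
Definition cell B e v : {ffun 'I_d -> 'I_(Num.truncn (2 * B / e)).+1} :=
  [ffun k => inord (Num.truncn ((v ord0 k + B) / e))].

Lemma cell_close B e v w : 0 < e ->
  (forall k, `|v ord0 k| <= B) -> (forall k, `|w ord0 k| <= B) ->
  cell B e v = cell B e w -> forall k, `|v ord0 k - w ord0 k| <= e.
Proof.
move=> e0 vB wB vw k.
have := congr1 (fun f : {ffun _ -> _} => val (f k)) vw.
have bd (u : 'rV[R]_d) : `|u ord0 k| <= B -> 0 <= (u ord0 k + B) / e /\
    (Num.truncn ((u ord0 k + B) / e) < (Num.truncn (2 * B / e)).+1)%N.
  rewrite ler_norml => /andP[h1 h2].
  have h3 : 0 <= (u ord0 k + B) / e by rewrite divr_ge0 ?(ltW e0) //; lra.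
  split => //; rewrite ltnS truncn_ge_nat; last first.
    by rewrite divr_ge0 ?(ltW e0) //; lra.
  apply: le_trans (_ : (u ord0 k + B) / e <= _).
    by rewrite truncn_le.
  by rewrite ler_pM2r ?invr_gt0 //; lra.
have [v1 v2] := bd _ (vB k); have [w1 w2] := bd _ (wB k).
rewrite /= !ffunE !inordK // => vwE.
have /andP[] := truncn_itv v1; have /andP[] := truncn_itv w1; rewrite vwE.
set n := Num.truncn _; rewrite -natr1 !ler_pdivlMr // !ltr_pdivrMr // => p1 p2 p3 p4.
rewrite ler_norml; apply/andP; split; lra.
Qed.

Lemma pack_le (I : finType) (A : {set I}) (v : I -> 'rV[R]_d) B e : 0 < e ->
  (forall i, i \in A -> forall k, `|v i ord0 k| <= B) ->
  (forall i j, i \in A -> j \in A -> i != j ->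
     ~ forall k, `|v i ord0 k - v j ord0 k| <= e) ->
  (#|A| <= (Num.truncn (2 * B / e)).+1 ^ d)%N.
Proof.
move=> e0 vB sep.
rewrite -(@card_in_imset _ _ (fun i => cell B e (v i))); last first.
  move=> i j iA jA cij; apply/eqP/negPn/negP => ij.
  by apply: (sep i j iA jA ij); apply: cell_close (vB i iA) (vB j jA) cij.
by apply: leq_trans (max_card _) _; rewrite card_ffun !card_ord.
Qed.

Lemma card_fibers (I J : finType) (f : I -> J) (M : nat) :
  (forall j, #|[pred i | f i == j]| <= M)%N -> (#|I| <= M * #|J|)%N.
Proof.
move=> fM; rewrite -sum1_card (partition_big f predT) //=.
rewrite mulnC -sum_nat_const; apply: leq_sum => j _.
by apply: leq_trans (fM j); rewrite -sum1_card.
Qed.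

End Pigeonhole.

(** Jensen's inequality with total weight at most 1: the condition at 0 absorbs the missing
    weight. *)
Lemma sublevel_sum (R : realType) (V : lmodType R) (phi : V -> R) (c : R) (I : Type)
    (r : seq I) (v : I -> V) (a : I -> R) :
  convexf phi -> phi 0 <= c -> (forall i, phi (v i) <= c) -> (forall i, 0 <= a i) ->
  \sum_(i <- r) a i <= 1 -> phi (\sum_(i <- r) a i *: v i) <= c.
Proof.
move=> cphi phi0 phiv; elim: r a => [|i r IH] a a0; first by rewrite !big_nil.
rewrite !big_cons => ai1.
have s0 : 0 <= \sum_(j <- r) a j by apply: sumr_ge0.
have conv t x y : 0 <= t -> t <= 1 -> phi x <= c -> phi y <= c ->
    phi (t *: x + (1 - t) *: y) <= c.
  move=> t0 t1 xc yc; apply: le_trans (cphi t x y t0 t1) _.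
  have := ler_wpM2l t0 xc; have := ler_wpM2l (_ : 0 <= 1 - t) yc.
  by rewrite subr_ge0 => /(_ t1); lra.
(* The renormalisation further on divides by [1 - a i]; if [a i] is 1, the remaining weights all
   vanish. *)
have [ai|ai] := eqVneq (a i) 1.
  have sum0 : \sum_(j <- r) a j = 0 by apply/eqP; rewrite eq_le s0 andbT; lra.
  have h : \sum_(j <- r) a j *: v j = 0 *: (\sum_(j <- r) a j *: v j).
    rewrite scale0r; elim: r s0 sum0 {IH ai1} => [|j r IHr] s0; first by rewrite !big_nil.
    rewrite !big_cons => /eqP; rewrite paddr_eq0 ?sumr_ge0 // => /andP[/eqP-> /eqP h].
    by rewrite scale0r add0r IHr ?h.
  by rewrite h scale0r ai scale1r addr0.
have ai_lt : 0 < 1 - a i by rewrite subr_gt0 lt_neqAle ai /=; lra.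
have -> : \sum_(j <- r) a j *: v j =
    (1 - a i) *: \sum_(j <- r) (a j / (1 - a i)) *: v j.
  rewrite scaler_sumr; apply: eq_bigr => j _; rewrite scalerA mulrC divfK //.
  by rewrite gt_eqF.
apply: conv => //; first by lra.
apply: IH => [j|]; first by rewrite divr_ge0 // ltW.
by rewrite -mulr_suml ler_pdivrMr // mul1r; lra.
Qed.

(* The body {v | secdiff g x v <= c} seen as a box: in the coordinates v *m T it lies
   between the cubes of half-side 1/d and 2. *)
Definition frame (R : realType) (d : nat) (g : 'rV[R]_d -> R) (c : R) (x : 'rV[R]_d)
    (T : 'M[R]_d) :=
  (forall v k, secdiff g x v <= c -> `|(v *m T) ord0 k| <= 2) /\
  (forall v, (forall k, `|(v *m T) ord0 k| <= d%:R^-1) -> secdiff g x v <= c).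

(** * Frames of the bodies and their Euclidean size *)

Section Frames.
Variables (R : realType) (d : nat) (f : 'rV[R]_d -> R).
Hypotheses (d0 : (0 < d)%N) (cf : convexf f)
  (lipf : forall x y, `|f x - f y| <= enorm (x - y)).
Implicit Types (x y u v w p : 'rV[R]_d) (s : R).

(* The quadratic term bounds the bodies {v | secdiff g x v <= c}. *)
Definition addsq (x : 'rV[R]_d) : R := f x + dot x x / 2.
Local Notation g := addsq.

Lemma convexf_addsq : convexf g.
Proof.
move=> t x y t0 t1; have := cf x y t0 t1; rewrite /g.
rewrite dotDl !dotDr !dotZl !dotZr (dotC y x).
have : 0 <= t * (1 - t) * dot (x - y) (x - y).
  by rewrite !mulr_ge0 ?subr_ge0 // -sqr_enorm sqr_ge0.
rewrite dotBl !dotBr (dotC y x); lra.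
Qed.
Local Hint Resolve convexf_addsq : core.

Lemma secdiff_addsq x v : secdiff g x v = secdiff f x v + dot v v.
Proof. by rewrite /secdiff /g dotDl dotBl !dotDr !dotNr (dotC v x); field. Qed.

Lemma enorm_secdiff s x v : 0 <= s -> secdiff g x v <= s ^+ 2 -> enorm v <= s.
Proof.
move=> s0; rewrite secdiff_addsq -sqr_enorm => h.
rewrite -(@ler_pXn2r _ 2) ?nnegrE ?enorm_ge0 //.
by have := secdiff_ge0 cf x v; lra.
Qed.

Lemma convexf_secdiff x : convexf (secdiff g x).
Proof.
move=> t v w t0 t1; rewrite /secdiff.
have := convexf_addsq (x + v) (x + w) t0 t1.
have := convexf_addsq (x - v) (x - w) t0 t1.
have -> : t *: (x + v) + (1 - t) *: (x + w) = x + (t *: v + (1 - t) *: w).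
  by apply/rowP => i; rewrite !mxE; ring.
have -> : t *: (x - v) + (1 - t) *: (x - w) = x - (t *: v + (1 - t) *: w).
  by apply/rowP => i; rewrite !mxE; ring.
lra.
Qed.

Lemma secdiff0 x : secdiff g x 0 = 0.
Proof. by rewrite /secdiff subr0 addr0; ring. Qed.

(** The rows of the inverse of [T] span a nearly maximal parallelepiped in the body. A vector with
    coordinates at most [1 / d] is the average of [d] multiples of these rows with factors in
    [-1, 1], which convexity and symmetry keep in the body. *)
Lemma frame_exists s x : 0 < s -> s <= 1 -> exists T, frame g (s ^+ 2) x T.
Proof.
move=> s0 s1.
(* For a vector of norm [s ^+ 2 / 3], the two differences of [f] cost at most two thirds of
   [s ^+ 2], and the square at most the last third because [s <= 1]. *)
have [|||M [uM rM hM]] := @approx_auerbach R d [set v | secdiff g x v <= s ^+ 2] s (s ^+ 2 / 3).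
- by rewrite divr_gt0 // exprn_gt0.
- move=> v /= /enorm_secdiff h i; apply: le_trans (coord_le_enorm v i) (h _); exact: ltW.
- move=> k /=; rewrite secdiff_addsq; set v := _ *: _.
  have s2 : 0 < s ^+ 2 by rewrite exprn_gt0.
  have nv : enorm v = s ^+ 2 / 3.
    by rewrite /v enormZ ger0_norm ?divr_ge0 ?(ltW s2) // enorm_delta mulr1.
  have := lipf (x + v) x; have := lipf (x - v) x.
  rewrite [x + v]addrC [x - v]addrC !addrK enormN nv -sqr_enorm nv /secdiff !ler_norml.
  rewrite ![_ + x]addrC => /andP[_ h1] /andP[_ h2].
  have : (s ^+ 2 / 3) ^+ 2 <= s ^+ 2 / 3 * 1.
    rewrite expr2 ler_pM2l ?divr_gt0 //.
    have : s ^+ 2 <= 1 by rewrite expr_le1 // ltW.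
    lra.
  lra.
exists (invmx M); split => [v k|v hv]; first exact: hM.
have -> : v = \sum_(k < d) d%:R^-1 *: ((d%:R * (v *m invmx M) ord0 k) *: row k M).
  rewrite -[LHS](mulmxKV uM) [LHS]mulmx_sum_row; apply: eq_bigr => k _.
  by rewrite scalerA mulKf // pnatr_eq0 -lt0n.
apply: sublevel_sum (convexf_secdiff x) _ _ _ _ => [|k|k|].
- by rewrite secdiff0 sqr_ge0.
- have hk : `|d%:R * (v *m invmx M) ord0 k| <= 1.
    rewrite normrM normr_nat mulrC -ler_pdivlMr ?ltr0n //.
    by rewrite div1r.
  have mk : secdiff g x (row k M) <= s ^+ 2 := rM k.
  have := secdiff_ge0 convexf_addsq x (row k M).
  case: (ltrP 0 (d%:R * (v *m invmx M) ord0 k)) hk => [c0|c0] hk h0.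
    rewrite gtr0_norm // in hk.
    apply: le_trans (secdiffZ convexf_addsq _ _ (ltW c0) hk) _.
    by apply: le_trans mk; rewrite ler_piMl.
  rewrite ler0_norm // in hk.
  rewrite -secdiffN -scaleNr.
  apply: le_trans (secdiffZ convexf_addsq _ _ _ hk) _; first by rewrite oppr_ge0.
  by apply: le_trans mk; rewrite ler_piMl.
- by rewrite invr_ge0 ler0n.
- by rewrite sumr_const card_ord -[_ *+ d]mulr_natr mulVf // pnatr_eq0 -lt0n.
Qed.

Lemma frame_scale c x T v (e : R) : frame g c x T -> 0 < e ->
  (forall k, `|(v *m T) ord0 k| <= e) -> secdiff g x ((d%:R * e)^-1 *: v) <= c.
Proof.
move=> [_ hT] e0 hv; apply: hT => k.
rewrite -scalemxAl mxE normrM ger0_norm ?invr_ge0 ?mulr_ge0 ?ler0n ?(ltW e0) //.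
rewrite invfM -mulrA ler_piMr ?invr_ge0 ?ler0n //.
by rewrite mulrC ler_pdivrMr // mul1r.
Qed.

(** Here the quadratic term of [addsq] enters the count: a body at scale [s] has Euclidean radius at
    most [s], so frame coordinates control distances. *)
Lemma frame_enorm s x T v (e : R) : frame g (s ^+ 2) x T -> 0 < s -> 0 < e ->
  (forall k, `|(v *m T) ord0 k| <= e) -> enorm v <= d%:R * e * s.
Proof.
move=> hT s0 e0 hv; have := frame_scale hT e0 hv => /(enorm_secdiff (ltW s0)).
have de : 0 < d%:R * e by rewrite mulr_gt0 // ltr0n.
by rewrite enormZ gtr0_norm ?invr_gt0 // mulrC ler_pdivrMr // mulrC.
Qed.

End Frames.

(** * Close central slopes force comparable bodies *)

Definition central (R : realType) (d : nat) (g : 'rV[R]_d -> R) (c : R) (x : 'rV[R]_d)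
    (T : 'M[R]_d) (P : 'rV[R]_d) :=
  forall v, - c <= g (x + v) - g x - dot P v /\
    ((exists k, 16 * d%:R <= `|(v *m T) ord0 k|) -> c <= g (x + v) - g x - dot P v).

Section Counting.
Variables (R : realType) (d : nat) (f : 'rV[R]_d -> R).
Hypotheses (d0 : (0 < d)%N) (cf : convexf f).
Variable s : R.
Hypothesis s0 : 0 < s.
Implicit Types (x y u v w p : 'rV[R]_d).
Local Notation g := (addsq f).
Local Notation D := (d%:R : R).
Let cg : convexf g := convexf_addsq cf.
Let Dge1 : 1 <= D. Proof. by rewrite ler1n. Qed.
Let s2gt0 : 0 < s ^+ 2. Proof. by rewrite exprn_gt0. Qed.

Section Pair.
Variables (x y : 'rV[R]_d) (Tx Ty : 'M[R]_d) (Px Py : 'rV[R]_d).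
Hypothesis fx : frame g (s ^+ 2) x Tx.
Hypotheses (hx : central g (s ^+ 2) x Tx Px) (hy : central g (s ^+ 2) y Ty Py).

Let kx v := g (x + v) - g x - dot Px v.
Let ky v := g (y + v) - g y - dot Py v.

Let kxy : kx (y - x) + ky (x - y) = dot (Py - Px) (y - x).
Proof.
rewrite /kx /ky [x + (y - x)]addrC subrK [y + (x - y)]addrC subrK dotBl.
by rewrite -(opprB y x) dotNr; ring.
Qed.

(** Let [u = y - x] and let [t] be its largest coordinate in units of [16 * D]. Convexity along the
    ray from [x] gives [kx u >= t * s ^+ 2], while [ky (- u) >= - s ^+ 2]. Their sum is the slope
    difference paired with [u], whose norm is at most [16 * D ^+ 2 * t * s]; Cauchy-Schwarz and
    [t >= 2] conclude. *)
Lemma central_slope_gap : (exists k, 32 * D <= `|((y - x) *m Tx) ord0 k|) ->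
  s / (32 * D ^+ 2) <= enorm (Py - Px).
Proof.
have D1 := Dge1; have s2 := s2gt0; set u := y - x => -[k0 hk0].
pose k := [arg max_(k > k0) `|(u *m Tx) ord0 k|]%O.
have hmax k' : `|(u *m Tx) ord0 k'| <= `|(u *m Tx) ord0 k|.
  by rewrite /k; case: arg_maxP => // i _; exact.
set tau := `|(u *m Tx) ord0 k| in hmax.
have tau32 : 32 * D <= tau := le_trans hk0 (hmax k0).
pose t := tau / (16 * D).
have D0 : 0 < 16 * D by lra.
have t2 : 2 <= t by rewrite /t ler_pdivlMr //; lra.
have t0 : 0 < t by lra.
have kxu : t * s ^+ 2 <= kx u.
  have [_ h] := hx (t^-1 *: u).
  have {}h := h (ex_intro _ k _).
  have : s ^+ 2 <= kx (t^-1 *: u).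
    apply: h; rewrite -scalemxAl mxE normrM gtr0_norm ?invr_gt0 //.
    by rewrite -/tau /t invf_div divfK // gt_eqF //; lra.
  have ti0 : 0 <= t^-1 by rewrite invr_ge0 ltW.
  have ti1 : t^-1 <= 1 by rewrite invf_le1 //; lra.
  have := cg (x + u) x ti0 ti1.
  have -> : t^-1 *: (x + u) + (1 - t^-1) *: x = x + t^-1 *: u.
    by apply/rowP => i; rewrite !mxE; ring.
  rewrite /kx dotZr => h1 h2.
  have : s ^+ 2 <= t^-1 * (g (x + u) - g x - dot Px u) by lra.
  by rewrite mulrC ler_pdivlMr // mulrC.
have kyu : - s ^+ 2 <= ky (- u) by have [] := hy (- u).
have nu : enorm u <= D * tau * s.
  by apply: (frame_enorm d0 cf fx) => //; lra.
have tauE : tau = t * (16 * D) by rewrite /t divfK // gt_eqF.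
have e1 := dot_le (Py - Px) u.
have : t * s ^+ 2 - s ^+ 2 <= enorm (Py - Px) * (D * tau * s).
  apply: le_trans (_ : dot (Py - Px) u <= _).
    by rewrite -kxy -/u -(opprB y x); lra.
  by apply: le_trans e1 _; rewrite ler_wpM2l ?enorm_ge0.
rewrite tauE => h.
rewrite ler_pdivrMr; last by rewrite mulr_gt0 // exprn_gt0 //; lra.
rewrite -(@ler_pM2l _ (t * s / 2)); last by rewrite divr_gt0 // mulr_gt0.
have -> : t * s / 2 * (enorm (Py - Px) * (32 * D ^+ 2)) =
  enorm (Py - Px) * (D * (t * (16 * D)) * s) by field.
apply: le_trans h; rewrite -subr_ge0; move: (t) t2 => r r2.
have -> : r * s ^+ 2 - s ^+ 2 - r * s / 2 * s = (r - 2) * s ^+ 2 / 2 by field.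
by rewrite divr_ge0 // mulr_ge0 ?subr_ge0 ?(ltW s2).
Qed.

Hypothesis Pxy : enorm (Py - Px) < s / (32 * D ^+ 2).

Lemma close_coord k : `|((y - x) *m Tx) ord0 k| <= 32 * D.
Proof.
rewrite leNgt; apply/negP => /ltW h.
by have := central_slope_gap (ex_intro _ k h); rewrite leNgt Pxy.
Qed.

Let nxy : enorm (y - x) <= D * (32 * D) * s.
Proof. by have D1 := Dge1; apply: (frame_enorm d0 cf fx) close_coord => //; lra. Qed.

(** By Cauchy-Schwarz the two tilted differences sum to at most [s ^+ 2], and the one at [y] is at
    least [- s ^+ 2]. *)
Lemma close_section : kx (y - x) <= 2 * s ^+ 2.
Proof.
have D1 := Dge1; have [h _] := hy (x - y).
have : kx (y - x) + ky (x - y) <= s ^+ 2.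
  rewrite kxy; apply: le_trans (dot_le _ _) _.
  have -> : s ^+ 2 = s / (32 * D ^+ 2) * (D * (32 * D) * s).
    by field; lra.
  by apply: ler_pM; rewrite ?enorm_ge0 // ltW.
rewrite -/(ky (x - y)) in h; lra.
Qed.

(** The body of [y] is shrunk towards [x] to the base point [x + th *: u], where the central slope
    bounds [g] from below, and then moved back to [x] by [secdiff_unshift]. The constant is
    [64 * 4 * 2]. *)
Lemma close_engulf w : secdiff g y w <= s ^+ 2 ->
  secdiff g x ((512 * D ^+ 2)^-1 *: w) <= s ^+ 2.
Proof.
have D1 := Dge1; have s2 := s2gt0; move=> hw; set th := (64 * D ^+ 2)^-1.
have D2 : 1 <= D ^+ 2 by rewrite exprn_ege1.
have th0 : 0 < th by rewrite invr_gt0; lra.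
have th1 : th <= 64^-1 by rewrite lef_pV2 ?posrE; lra.
set u := y - x.
(* [th] is chosen for this: the frame coordinates of [u] are at most [32 * D]. *)
have h1 : secdiff g x (2 *: (th *: u)) <= s ^+ 2.
  have := frame_scale fx (_ : 0 < 32 * D) close_coord.
  rewrite scalerA; have -> : 2 * th = (d%:R * (32 * D))^-1 by rewrite /th; field; lra.
  by apply; lra.
have hz : secdiff g (x + th *: u) (th *: w) <= 4 * s ^+ 2.
  have e (w' : 'rV[R]_d) : x + th *: u + th *: w' = th *: (y + w') + (1 - th) *: x.
    by apply/rowP => i; rewrite !mxE; ring.
  have := cg (y + w) x (ltW th0) (_ : th <= 1).
  have := cg (y - w) x (ltW th0) (_ : th <= 1).
  rewrite -!e scalerN => /(_ ltac:(lra)) g1 /(_ ltac:(lra)) g2.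
  have [k1 _] := hx (th *: u).
  have := close_section; rewrite /kx -/u [x + u]addrC subrK => k2.
  have k3 : th * (g y - g x - dot Px u) <= th * (2 * s ^+ 2) by rewrite ler_pM2l.
  have k4 : th * s ^+ 2 <= 64^-1 * s ^+ 2 by rewrite ler_pM2r.
  move: k1; rewrite dotZr => k1.
  have k5 : th * secdiff g y w <= th * s ^+ 2 by rewrite ler_pM2l.
  move: k5; rewrite /secdiff => k5.
  lra.
have hz4 : secdiff g (x + th *: u) (4^-1 *: (th *: w)) <= s ^+ 2.
  have := @secdiffZ _ _ g cg (x + th *: u) (th *: w) 4^-1 ltac:(lra) ltac:(lra); lra.
have := secdiff_unshift cg x (th *: u) (4^-1 *: (th *: w)).
have := secdiff_half cg x (th *: u).
have -> : 2^-1 *: (4^-1 *: (th *: w)) = (512 * D ^+ 2)^-1 *: w.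
  by rewrite !scalerA /th; congr (_ *: _); field; lra.
lra.
Qed.

End Pair.
End Counting.

(** One-sided, as greedy selection produces it: only a later point is tested against the shrunk body
    of an earlier one. *)
Definition separated (R : realType) (d : nat) (g : 'rV[R]_d -> R) (s : R)
    (X : seq 'rV[R]_d) :=
  forall j k, (j < k)%N -> (k < size X)%N ->
    ~ secdiff g X`_j ((4 * d%:R ^+ 2) *: (X`_k - X`_j)) <= s ^+ 2.

(** The bound of [pack_le] for points whose slopes share a grid cell. The mesh combines the factors
    [512 * d ^+ 2] of [close_engulf], [4 * d ^+ 2] of [separated] and [d] of [frame_scale]. *)
Definition clusterM (R : realType) (d : nat) : nat :=
  (Num.truncn (2 * (32 * d%:R) / (2048 * d%:R ^+ 5)^-1 : R)).+1 ^ d.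

Section Count.
Variables (R : realType) (d : nat) (f : 'rV[R]_d -> R).
Hypotheses (d0 : (0 < d)%N) (cf : convexf f)
  (lipf : forall x y, `|f x - f y| <= enorm (x - y)).
Variable s : R.
Hypotheses (s0 : 0 < s) (s1 : s <= 1).
Implicit Types (x y u v w p : 'rV[R]_d).
Local Notation g := (addsq f).
Local Notation D := (d%:R : R).

Lemma frame_central_exists x : exists TP : 'M[R]_d * 'rV[R]_d,
  frame g (s ^+ 2) x TP.1 /\ central g (s ^+ 2) x TP.1 TP.2.
Proof.
have [T hT] := frame_exists d0 cf lipf x s0 s1.
have s2 : 0 < s ^+ 2 by rewrite exprn_gt0.
have [P hP] := central_slope d0 (convexf_addsq cf) s2 hT.1.
by exists (T, P).
Qed.

(** A unit step raises [f] by at most 1 and the quadratic term by at most 3/2; the slack in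
    [central] is at most 1. *)
Lemma central_bound x T P : enorm x <= 1 -> central g (s ^+ 2) x T P ->
  forall k, `|P ord0 k| <= 4.
Proof.
move=> x1 hP k.
have ss : s ^+ 2 <= 1 by rewrite expr_le1 // ltW.
have bd v : enorm v = 1 -> dot P v <= 4.
  move=> v1; have [h _] := hP v; move: h.
  rewrite /addsq dotDl !dotDr -(sqr_enorm v) v1 (dotC v x).
  have := dot_le x v; rewrite v1 mulr1.
  have := lipf (x + v) x; rewrite [x + v]addrC addrK v1 ler_norml => /andP[_].
  lra.
rewrite ler_norml -dot_delta; have := bd _ (enorm_delta _ k).
have := bd (- delta_mx ord0 k); rewrite enormN enorm_delta dotNr => /(_ erefl).
lra.
Qed.

(** Double pigeonhole. A grid on the slopes, of mesh proportional to [s], gives the factor of order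
    [s ^- d]. Points in one grid cell have comparable bodies, so in the frame of one of them they
    form a packing of constant size. *)
Lemma separated_size X : (forall x, x \in X -> enorm x <= 1) -> separated g s X ->
  (size X <= clusterM R d * (Num.truncn (2 * 4 / (s / (64 * D ^+ 3)))).+1 ^ d)%N.
Proof.
move=> X1 sepX.
have [TP hTP] := choice frame_central_exists.
have D1 : 1 <= D by rewrite ler1n.
pose x (i : 'I_(size X)) := X`_i.
have xX i : x i \in X by rewrite mem_nth.
pose P i := (TP (x i)).2; pose T i := (TP (x i)).1.
have fT i : frame g (s ^+ 2) (x i) (T i) := (hTP (x i)).1.
have cP i : central g (s ^+ 2) (x i) (T i) (P i) := (hTP (x i)).2.
have Pb i k : `|P i ord0 k| <= 4 by apply: central_bound (X1 _ (xX i)) (cP i) k.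
set e := s / (64 * D ^+ 3).
have D3 : 0 < D ^+ 3 by rewrite exprn_gt0; lra.
have e0 : 0 < e by rewrite divr_gt0 //; lra.
have D2 : 0 < D ^+ 2 by rewrite exprn_gt0; lra.
have := @card_fibers _ _ (fun i => cell 4 e (P i)) (clusterM R d).
rewrite card_ord card_ffun !card_ord; apply => c.
rewrite -cardsE; set A := finset _.
have [->|[i1 i1A]] := set_0Vmem A; first by rewrite cards0.
have closeA i j : i \in A -> j \in A -> enorm (P i - P j) < s / (32 * D ^+ 2).
  rewrite !inE => /eqP ic /eqP jc.
  have : enorm (P i - P j) <= D * e.
    apply: enorm_le_coord => k; rewrite !mxE.
    by apply: (cell_close e0 (Pb i) (Pb j)); rewrite ic jc.
  move/le_lt_trans; apply.
  have -> : D * e = s / (32 * D ^+ 2) / 2 by rewrite /e; field; lra.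
  by rewrite ltr_pdivrMr // ltr_pMr ?divr_gt0 //; lra.
have e20 : 0 < (2048 * D ^+ 5)^-1.
  have D5 : 0 < D ^+ 5 by rewrite exprn_gt0; lra.
  rewrite invr_gt0; lra.
apply: (@pack_le R d _ A (fun i => (x i - x i1) *m T i1)) => //.
  move=> i iA k; exact: (close_coord d0 cf s0 (fT i1) (cP i1) (cP i) (closeA _ _ iA i1A)).
move=> i j iA jA; rewrite neq_ltn => ij h.
(* Separation speaks only of a later point against an earlier one. *)
wlog {ij} ij : i j iA jA h / (i < j)%N.
  move=> wl; case/orP: ij => ij; first exact: (wl i j).
  by apply: (wl j i) => // k; rewrite distrC.
apply: (sepX i j ij (ltn_ord j)).
have {h} h k : `|((x j - x i) *m T i1) ord0 k| <= (2048 * D ^+ 5)^-1.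
  have := h k; rewrite distrC; congr (`|_| <= _).
  by rewrite !mulmxBl !mxE; ring.
have h1 := frame_scale (fT i1) e20 h.
(* The scaled difference lies in the body of [x i1]; engulfing carries it to the earlier point
   [x i], with factor exactly [4 * D ^+ 2]. *)
have := close_engulf d0 cf s0 (fT i) (cP i) (cP i1) (closeA _ _ i1A iA) h1.
have E : (512 * D ^+ 2)^-1 * (D * (2048 * D ^+ 5)^-1)^-1 = 4 * D ^+ 2 by field; lra.
by rewrite scalerA E.
Qed.

Lemma separated_size_real X : (forall x, x \in X -> enorm x <= 1) -> separated g s X ->
  (size X)%:R <= (clusterM R d)%:R * (512 * D ^+ 3 + 1) ^+ d * s ^- d.
Proof.
move=> X1 /(separated_size X1).
have D1 : 1 <= D by rewrite ler1n.
have D3 : 0 < D ^+ 3 by rewrite exprn_gt0; lra.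
have K0 : 0 <= 512 * D ^+ 3 by lra.
have -> : 2 * 4 / (s / (64 * D ^+ 3)) = 512 * D ^+ 3 / s.
  by field; rewrite !gt_eqF //; lra.
move: (512 * D ^+ 3) K0 => K K0.
rewrite -(ler_nat R) natrM natrX => /le_trans; apply.
rewrite -[leRHS]mulrA ler_wpM2l // -exprVn -exprMn.
apply: lerXn2r; rewrite ?nnegrE ?ler0n ?mulr_ge0 ?invr_ge0 ?addr_ge0 ?(ltW s0) //.
have /truncn_itv/andP[h _] : 0 <= K / s by rewrite divr_ge0 // ltW.
by rewrite -natr1 mulrDl lerD // mul1r invf_ge1.
Qed.

End Count.

(** An ellipsoid in place of a box: one polynomial inequality, hence a single branch of the program.
    Its radius [1 / (2 * d)] in frame coordinates fits between the bodies of [in_cell_cover] and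
    [in_cell_body]. *)
Definition in_cell (R : realType) (d : nat) (T : 'M[R]_d) (x0 x : 'rV[R]_d) : bool :=
  \sum_(k < d) ((x - x0) *m T) ord0 k ^+ 2 <= (4 * d%:R ^+ 2)^-1.

(** The mesh combines the factors 24 of [child_engulf], [4 * d ^+ 2] of [separated] and [d] of
    [frame_scale]. *)
Definition childM (R : realType) (d : nat) : nat :=
  (Num.truncn (2 * 5 / (96 * d%:R ^+ 3)^-1 : R)).+1 ^ d.

(** * Nets at one scale and links between consecutive scales *)

Section Nets.
Variables (R : realType) (d : nat) (f : 'rV[R]_d -> R).
Hypotheses (d0 : (0 < d)%N) (cf : convexf f)
  (lipf : forall x y, `|f x - f y| <= enorm (x - y)).
Implicit Types (x y u v w p : 'rV[R]_d) (s : R) (T : 'M[R]_d).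
Local Notation g := (addsq f).
Local Notation D := (d%:R : R).

(** A separated list that does not cover the ball can be extended by an uncovered point; were no
    list covering, this would never stop, against [separated_size]. *)
Lemma net_exists s : 0 < s -> s <= 1 -> exists X : seq 'rV[R]_d,
  [/\ forall x, x \in X -> enorm x <= 1, separated g s X &
      forall x, enorm x <= 1 -> exists2 i, (i < size X)%N &
        secdiff g X`_i ((4 * D ^+ 2) *: (x - X`_i)) <= s ^+ 2].
Proof.
move=> s0 s1; apply: contrapT => noX.
suff H n : exists X : seq 'rV[R]_d,
    [/\ forall x, x \in X -> enorm x <= 1, separated g s X & size X = n].
  set b := (clusterM R d * (Num.truncn (2 * 4 / (s / (64 * D ^+ 3)))).+1 ^ d)%N.
  have [X [X1 sX szX]] := H b.+1.
  by have := separated_size d0 cf lipf s0 s1 X1 sX; rewrite szX -/b ltnn.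
elim: n => [|n [X [X1 sX szX]]]; first by exists [::].
have [x [x1 xX]] : exists x, enorm x <= 1 /\ forall i, (i < size X)%N ->
    ~ secdiff g X`_i ((4 * D ^+ 2) *: (x - X`_i)) <= s ^+ 2.
  apply: contrapT => nox; apply: noX; exists X; split => // x x1.
  apply: contrapT => noi; apply: nox; exists x; split=> // i iX h.
  by apply: noi; exists i.
exists (rcons X x); split.
- by move=> y; rewrite mem_rcons inE => /orP[/eqP->|/X1].
- move=> j k jk; rewrite size_rcons ltnS leq_eqVlt => /orP[/eqP kX|kX].
    by rewrite !nth_rcons -kX jk ltnn eqxx; apply: xX; rewrite -kX.
  by rewrite !nth_rcons kX (ltn_trans jk kX); exact: sX.
- by rewrite size_rcons szX.
Qed.

Lemma in_cell_cover s x0 T x : frame g (s ^+ 2) x0 T ->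
  secdiff g x0 ((4 * D ^+ 2) *: (x - x0)) <= s ^+ 2 -> in_cell T x0 x.
Proof.
move=> [hT _] h; have D1 : 1 <= D by rewrite ler1n.
have D2 : 1 <= D ^+ 2 by rewrite exprn_ege1.
rewrite /in_cell; apply: le_trans (_ : \sum_(k < d) (2 * D ^+ 2)^-1 ^+ 2 <= _).
  apply: ler_sum => k _; rewrite -real_normK ?num_real //.
  apply: lerXn2r; rewrite ?nnegrE ?normr_ge0 ?invr_ge0 //.
  have := hT _ k h; rewrite -scalemxAl mxE normrM (@gtr0_norm _ (4 * D ^+ 2)); last by lra.
  rewrite -[(2 * _)^-1]mul1r ler_pdivlMr; last by lra.
  lra.
rewrite sumr_const card_ord -[_ *+ d]mulr_natr.
have -> : (2 * D ^+ 2)^-1 ^+ 2 * D = (4 * D ^+ 2)^-1 * D^-1 by field; lra.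
by rewrite ler_piMr ?invf_le1 ?invr_ge0 //; lra.
Qed.

Lemma in_cell_body s x0 T x : frame g (s ^+ 2) x0 T -> in_cell T x0 x ->
  secdiff g x0 (2 *: (x - x0)) <= s ^+ 2.
Proof.
move=> [_ hT] h; have D1 : 1 <= D by rewrite ler1n.
apply: hT => k; rewrite -scalemxAl mxE normrM ger0_norm //.
have : `|((x - x0) *m T) ord0 k| <= (2 * D)^-1.
  rewrite -(@ler_pXn2r _ 2) ?nnegrE ?normr_ge0 ?invr_ge0 ?real_normK ?num_real //.
  have -> : (2 * D)^-1 ^+ 2 = (4 * D ^+ 2)^-1 by field; lra.
  apply: le_trans h; rewrite [leRHS](bigD1 k) //= lerDl.
  by apply: sumr_ge0 => i _; exact: sqr_ge0.
by rewrite invfM; lra.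
Qed.

Section Children.
Variables (s : R) (x0 : 'rV[R]_d) (T : 'M[R]_d).
Hypothesis fT : frame g (s ^+ 2) x0 T.
Let cg : convexf g := convexf_addsq cf.

(** The bound is [1 + 4], through the common point [y]: both [2 *: (y - x0)] and [2^-1 *: (y - x)]
    lie in the body at [x0]. *)
Lemma child_coord x y : secdiff g x0 (2 *: (y - x0)) <= s ^+ 2 ->
  secdiff g x (2 *: (y - x)) <= (s / 2) ^+ 2 ->
  forall k, `|((x - x0) *m T) ord0 k| <= 5.
Proof.
move=> h1 h2 k; have := fT.1 _ k h1.
have s2 : 0 <= s ^+ 2 by rewrite sqr_ge0.
have sh : (s / 2) ^+ 2 = s ^+ 2 / 4 by field.
rewrite -scalemxAl mxE normrM ger0_norm // => c1.
have := secdiff_shift_self cg x (y - x); rewrite subrKC => h3.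
have := secdiff_unshift cg x0 (y - x0) (y - x); rewrite subrKC => h4.
have := secdiff_half cg x0 (y - x0) => h5.
have : secdiff g x0 (2^-1 *: (y - x)) <= s ^+ 2 by lra.
move/(fT.1 _ k); rewrite -scalemxAl mxE normrM ger0_norm // => c2.
have -> : x - x0 = (y - x0) - (y - x) by rewrite opprB [RHS]addrC addrA subrK.
rewrite mulmxBl !mxE; apply: le_trans (ler_normB _ _) _.
by move: c1 c2; rewrite !mxE; lra.
Qed.

(** The body moves from [x0] to the common point [y] and on to [x]. Each move costs a factor 2, and
    a factor 6 between them lowers [3 / 2 * s ^+ 2] to [(s / 2) ^+ 2]. *)
Lemma child_engulf x y w : secdiff g x0 (2 *: (y - x0)) <= s ^+ 2 ->
  secdiff g x (2 *: (y - x)) <= (s / 2) ^+ 2 -> secdiff g x0 w <= s ^+ 2 ->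
  secdiff g x (24^-1 *: w) <= (s / 2) ^+ 2.
Proof.
move=> h1 h2 hw; have s2 : 0 <= s ^+ 2 by rewrite sqr_ge0.
have sh : (s / 2) ^+ 2 = s ^+ 2 / 4 by field.
have := secdiff_shift cg x0 (y - x0) w; rewrite subrKC => h3.
have := @secdiffZ _ _ g cg y (2^-1 *: w) 6^-1 ltac:(lra) ltac:(lra) => h4.
have := secdiff_unshift cg x (y - x) (6^-1 *: (2^-1 *: w)); rewrite subrKC => h5.
have := secdiff_half cg x (y - x) => h6.
have -> : 24^-1 *: w = 2^-1 *: (6^-1 *: (2^-1 *: w)).
  by rewrite !scalerA; congr (_ *: _); field.
lra.
Qed.

(** The packing argument of [separated_size], now in the frame of the parent cell. *)
Lemma children_le (X : seq 'rV[R]_d) (TX : 'I_(size X) -> 'M[R]_d) (A : {set 'I_(size X)}) :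
  separated g (s / 2) X ->
  (forall i : 'I_(size X), frame g ((s / 2) ^+ 2) X`_i (TX i)) ->
  (forall i : 'I_(size X), i \in A -> exists y, in_cell T x0 y /\ in_cell (TX i) X`_i y) ->
  (#|A| <= childM R d)%N.
Proof.
move=> sepX fX hA; have D1 : 1 <= D by rewrite ler1n.
have D3 : 0 < D ^+ 3 by rewrite exprn_gt0; lra.
have e0 : 0 < (96 * D ^+ 3)^-1 by rewrite invr_gt0; lra.
apply: (@pack_le R d _ A (fun i : 'I_(size X) => (X`_i - x0) *m T)) => //.
  move=> i /hA[y [/(in_cell_body fT) h1 /(in_cell_body (fX i)) h2]] k.
  exact: child_coord h1 h2 k.
move=> i j iA jA; rewrite neq_ltn => ij h.
wlog {ij} ij : i j iA jA h / (i < j)%N.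
  move=> wl; case/orP: ij => ij; first exact: (wl i j).
  by apply: (wl j i) => // k; rewrite distrC.
apply: (sepX i j ij (ltn_ord j)).
have {h} h k : `|((X`_j - X`_i) *m T) ord0 k| <= (96 * D ^+ 3)^-1.
  have := h k; rewrite distrC; congr (`|_| <= _).
  by rewrite !mulmxBl !mxE; ring.
have h1 := frame_scale fT e0 h.
have [y [/(in_cell_body fT) h2 /(in_cell_body (fX i)) h3]] := hA _ iA.
have := child_engulf h2 h3 h1.
have E : 24^-1 * (D * (96 * D ^+ 3)^-1)^-1 = 4 * D ^+ 2 by field; lra.
by rewrite scalerA E.
Qed.

End Children.

(** The affine function of a subgradient stays below [f] on both sides of [x0], so its error at [x]
    is at most the second difference, which the body bounds. *)
Lemma affine_on_cell s x0 T : frame g (s ^+ 2) x0 T ->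
  exists p, forall x, in_cell T x0 x -> `|f x0 + dot p (x - x0) - f x| <= s ^+ 2.
Proof.
move=> fT.
have [p hp] := subgradient x0 cf.
exists p => x /(in_cell_body fT) h.
have := secdiff_half (convexf_addsq cf) x0 (x - x0).
rewrite secdiff_addsq => h1.
have {h}h1 : secdiff f x0 (x - x0) + dot (x - x0) (x - x0) <= s ^+ 2 / 2 by lra.
have := hp (x - x0); have := hp (- (x - x0)); rewrite dotNr.
have := dot_ge0 (x - x0); move: h1; rewrite /secdiff subrKC.
have := sqr_ge0 s => *; rewrite ler_norml; apply/andP; split; lra.
Qed.

End Nets.

(** * Programs *)

Inductive expr (R : realType) (d : nat) : Type :=
| EConst (c : R)
| EInput (i : 'I_d)
| EAdd (a b : expr R d)
| EMul (a b : expr R d).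
Arguments EConst {R d} c.
Arguments EInput {R d} i.

Section Compile.
Variables (R : realType) (d : nat).
Implicit Types (e a b : expr R d) (prog c : seq (instr R d)) (regs : seq R) (x : 'rV[R]_d).
Local Notation halt := (IOutput R d 0).

Fixpoint esize e : nat :=
  match e with
  | EConst _ | EInput _ => 1
  | EAdd a b | EMul a b => (esize a + esize b).+1
  end.

Fixpoint eval_expr e x : R :=
  match e with
  | EConst c => c
  | EInput i => x ord0 i
  | EAdd a b => eval_expr a x + eval_expr b x
  | EMul a b => eval_expr a x * eval_expr b x
  end.

Fixpoint trace_expr e x : seq R :=
  match e with
  | EConst _ | EInput _ => [:: eval_expr e x]
  | EAdd a b | EMul a b => trace_expr a x ++ trace_expr b x ++ [:: eval_expr e x]
  end.

(* Code for e to be stored at address pc and entered with r registers in use;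
   its value is the last register it appends. *)
Fixpoint compile e (r pc : nat) : seq (instr R d) :=
  let bin op a b :=
    compile a r pc ++ compile b (r + esize a) (pc + esize a) ++
    [:: op (r + esize a).-1 (r + esize a + esize b).-1 (pc + esize a + esize b).+1] in
  match e with
  | EConst c => [:: IConst d c pc.+1]
  | EInput i => [:: IInput R i pc.+1]
  | EAdd a b => bin (@IAdd R d) a b
  | EMul a b => bin (@IMul R d) a b
  end.

Lemma esize_gt0 e : (0 < esize e)%N. Proof. by case: e. Qed.

Lemma size_compile e r pc : size (compile e r pc) = esize e.
Proof.
elim: e r pc => //= a IHa b IHb r pc; rewrite !size_cat IHa IHb /=; lia.
Qed.

Lemma size_trace e x : size (trace_expr e x) = esize e.
Proof. by elim: e => //= a IHa b IHb; rewrite !size_cat IHa IHb /=; lia. Qed.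

Lemma last_trace e x : nth 0 (trace_expr e x) (esize e).-1 = eval_expr e x.
Proof.
case: e => //= a b; rewrite catA nth_cat size_cat !size_trace ltnn subnn //.
Qed.

Definition code_at prog (pc : nat) c := forall k, (k < size c)%N ->
  (pc + k < size prog)%N /\ nth halt prog (pc + k) = nth halt c k.

Lemma code_at_cat prog pc c1 c2 : code_at prog pc (c1 ++ c2) ->
  code_at prog pc c1 /\ code_at prog (pc + size c1) c2.
Proof.
move=> h; split=> k kc.
  by have := h k; rewrite size_cat nth_cat kc ltn_addr // => /(_ isT).
have := h (size c1 + k)%N.
rewrite size_cat nth_cat ltn_add2l kc [(_ + k < size c1)%N]ltnNge leq_addr /= addKn addnA.
by move=> /(_ isT).
Qed.

Lemma nth_cat_trace regs e x :
  nth 0 (regs ++ trace_expr e x) (size regs + esize e).-1 = eval_expr e x.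
Proof.
have -> : (size regs + esize e).-1 = (size regs + (esize e).-1)%N.
  by have := esize_gt0 e; lia.
by rewrite nth_cat ltnNge leq_addr /= addKn last_trace.
Qed.

Lemma run_compile e prog pc regs x F : code_at prog pc (compile e (size regs) pc) ->
  run prog (esize e + F) pc regs x = run prog F (pc + esize e) (regs ++ trace_expr e x) x.
Proof.
have step i pc' : code_at prog pc' [:: i] -> (pc' < size prog)%N /\ nth halt prog pc' = i.
  by move=> /(_ 0 isT); rewrite addn0.
have bin a b regs' : nth 0 ((regs' ++ trace_expr a x) ++ trace_expr b x)
    (size regs' + esize a).-1 = eval_expr a x.
  rewrite nth_cat size_cat size_trace ltn_predL addn_gt0 esize_gt0 orbT.
  exact: nth_cat_trace.
have bin2 a b regs' : nth 0 ((regs' ++ trace_expr a x) ++ trace_expr b x)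
    (size regs' + esize a + esize b).-1 = eval_expr b x.
  by rewrite -(size_trace a x) -size_cat nth_cat_trace.
elim: e pc regs F => [c|i|a IHa b IHb|a IHa b IHb] pc regs F.
- by move=> /step[] /= -> ->; rewrite cats1 addn1.
- by move=> /step[] /= -> ->; rewrite cats1 addn1.
- move=> /code_at_cat[ha /code_at_cat[hb]]; rewrite !size_compile in hb * => /step[h1 h2].
  have -> : (esize (EAdd a b) + F = esize a + (esize b + F.+1))%N by rewrite /=; lia.
  rewrite IHa // IHb ?size_cat ?size_trace //= h1 h2 bin bin2 -!catA -cats1 !catA.
  by rewrite !addnS !addnA.
- move=> /code_at_cat[ha /code_at_cat[hb]]; rewrite !size_compile in hb * => /step[h1 h2].
  have -> : (esize (EMul a b) + F = esize a + (esize b + F.+1))%N by rewrite /=; lia.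
  rewrite IHa // IHb ?size_cat ?size_trace //= h1 h2 bin bin2 -!catA -cats1 !catA.
  by rewrite !addnS !addnA.
Qed.

(** Fuel can be rounded up, so every block is charged the same number of steps. *)
Lemma run_mono prog m n pc regs x v : (m <= n)%N ->
  run prog m pc regs x = Some v -> run prog n pc regs x = Some v.
Proof.
elim: m n pc regs => // m IH [|n] pc regs //; rewrite ltnS => mn /=.
case: ifP => // _.
case: (nth halt prog pc) => [? ?|? ?|? ? ?|? ? ?|? ? ?|? ? ?|? ?|? ? ?|?] //; try exact: IH.
by case: ifP => _; exact: IH.
Qed.

Fixpoint compile_seq (es : seq (expr R d)) (r pc : nat) : seq (instr R d) :=
  if es is e :: es' then compile e r pc ++ compile_seq es' (r + esize e) (pc + esize e) else [::].

Section Uniform.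
Variable S : nat.

Lemma size_compile_seq es r pc : all (fun e => esize e == S) es ->
  size (compile_seq es r pc) = (size es * S)%N.
Proof.
elim: es r pc => //= e es IH r pc /andP[/eqP eS hes].
by rewrite size_cat size_compile IH // eS mulSn.
Qed.

(** The common size [S] makes the register that holds the value of index [k] computable from [k]. *)
Lemma run_compile_seq es prog pc regs x : all (fun e => esize e == S) es ->
  code_at prog pc (compile_seq es (size regs) pc) ->
  exists tr, [/\ size tr = (size es * S)%N,
    forall k, (k < size es)%N ->
      nth 0 (regs ++ tr) (size regs + k * S + S.-1) = eval_expr (nth (EConst 0) es k) x &
    forall F, run prog (size es * S + F) pc regs x = run prog F (pc + size es * S) (regs ++ tr) x].
Proof.
elim: es pc regs => [|e es IH] pc regs /=.
  by move=> _ _; exists [::]; split => // F; rewrite ?mul0n ?addn0 ?cats0.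
move=> /andP[/eqP eS hes] /code_at_cat[h1 h2]; rewrite size_compile eS in h2.
have h3 : code_at prog (pc + S) (compile_seq es (size (regs ++ trace_expr e x)) (pc + S)).
  by rewrite size_cat size_trace eS.
have [tr [t1 t2 t3]] := IH _ _ hes h3.
exists (trace_expr e x ++ tr); split.
- by rewrite size_cat size_trace eS t1 mulSn.
- move=> [|k] /= kn.
    have S0 : (0 < S)%N by rewrite -eS esize_gt0.
    rewrite mul0n addn0 catA nth_cat size_cat size_trace eS ltn_add2l prednK // leqnn.
    by rewrite nth_cat ltnNge leq_addr /= addKn -eS last_trace.
  rewrite catA mulSn addnA -(t2 k) //; congr nth.
  by rewrite size_cat size_trace eS.
- move=> F; rewrite mulSn -addnA -{1}eS run_compile // eS t3 catA addnA //.
Qed.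

End Uniform.

Lemma run_branches prog pc regs x F M (j t : nat -> nat) k :
  code_at prog pc (mkseq (fun i => IBranch R d (j i) (t i) (pc + i.+1)) M) ->
  (k < M)%N -> 0 <= nth 0 regs (j k) ->
  (forall i, (i < k)%N -> nth 0 regs (j i) < 0) ->
  run prog (k.+1 + F) pc regs x = run prog F (t k) regs x.
Proof.
move=> h kM jk ji.
have H i : (i <= k)%N ->
    run prog (k.+1 + F) pc regs x = run prog (k.+1 - i + F) (pc + i) regs x.
  elim: i => [|i IH] ik; first by rewrite subn0 addn0.
  rewrite IH ?(ltnW ik) //; have iM : (i < M)%N by apply: leq_trans kM; exact: leqW.
  have := h i; rewrite size_mkseq nth_mkseq // => /(_ iM) [h1 h2].
  have -> : (k.+1 - i + F = (k.+1 - i.+1 + F).+1)%N by lia.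
  by rewrite /= h1 h2 leNgt ji.
rewrite (H k) // subSn // subnn /=.
by have := h k; rewrite size_mkseq nth_mkseq // => /(_ kM) [-> ->]; rewrite jk.
Qed.

End Compile.

Section Layered.
Variables (R : realType) (d : nat).
Implicit Types (prog : seq (instr R d)) (regs : seq R) (x : 'rV[R]_d).
Local Notation halt := (IOutput R d 0).

(* A decision node lists tests with the node to visit when the test is nonnegative;
   the first number is the count of registers in use on entry, which must not depend
   on the path taken since registers are addressed absolutely. *)
Definition node : Type := (nat * (seq (expr R d * nat) + expr R d))%type.

(** All tests are evaluated before the first branch, so every exit leaves the same number of
    registers in use. Blocks of a common length [B] turn node numbers into addresses. *)
Definition code (B S n : nat) (nd : node) : seq (instr R d) :=
  match nd with
  | (r, inl cs) => compile_seq (map fst cs) r (n * B) ++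
      mkseq (fun k => IBranch R d (r + k * S + S.-1) (nth 0 (map snd cs) k * B)%N
               (n * B + size cs * S + k.+1)) (size cs)
  | (r, inr e) => compile e r (n * B) ++ [:: IOutput R d (r + esize e).-1]
  end.

(** The default [halt] of [nth] fills up the blocks that are shorter than [B]. *)
Definition assemble (B S : nat) (nds : seq node) : seq (instr R d) :=
  mkseq (fun pc => nth halt (code B S (pc %/ B) (nth (0, inl [::]) nds (pc %/ B))) (pc %% B))
    (size nds * B).

Lemma code_at_assemble B S nds n nd : (n < size nds)%N ->
  nth (0, inl [::]) nds n = nd -> (size (code B S n nd) <= B)%N ->
  code_at (assemble B S nds) (n * B) (code B S n nd).
Proof.
move=> nn ndE szB k kc.
have kB : (k < B)%N := leq_trans kc szB.
have lt : (n * B + k < size nds * B)%N.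
  by apply: leq_trans (leq_mul nn (leqnn B)); rewrite mulSn addnC ltn_add2r.
rewrite size_mkseq; split => //; rewrite nth_mkseq // divnMDl; last by case: (B) kB.
by rewrite (divn_small kB) addn0 ndE modnMDl modn_small.
Qed.

Lemma run_leaf B S nds n r e regs x : (n < size nds)%N ->
  nth (0, inl [::]) nds n = (r, inr e) -> (esize e < B)%N -> size regs = r ->
  run (assemble B S nds) B (n * B) regs x = Some (eval_expr e x).
Proof.
move=> nn ndE eB szr.
have := @code_at_assemble B S _ _ _ nn ndE; rewrite /= size_cat size_compile addn1 => /(_ eB).
move=> /code_at_cat[]; rewrite -szr => h1 /(_ 0 isT); rewrite size_compile addn0 => -[h2 h3].
apply: (@run_mono _ _ _ (esize e + 1)); first by rewrite addn1.
by rewrite run_compile //= h2 h3 /= nth_cat_trace.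
Qed.

Lemma run_node B S nds n r cs regs x : (n < size nds)%N ->
  nth (0, inl [::]) nds n = (r, inl cs) ->
  all (fun c : expr R d * nat => esize c.1 == S) cs -> (size cs * S.+1 <= B)%N -> size regs = r ->
  has (fun c : expr R d * nat => 0 <= eval_expr c.1 x) cs ->
  exists k regs', let c := nth (EConst 0, 0%N) cs k in
    [/\ (k < size cs)%N, 0 <= eval_expr c.1 x, size regs' = (r + size cs * S)%N &
    forall F v, run (assemble B S nds) F (c.2 * B) regs' x = Some v ->
      run (assemble B S nds) (B + F) (n * B) regs x = Some v].
Proof.
move=> nn ndE csS csB szr hasc.
have csS' : all (fun e => esize e == S) (map fst cs) by rewrite all_map.
have := @code_at_assemble B S _ _ _ nn ndE.
rewrite /= size_cat (@size_compile_seq _ _ S) // size_map size_mkseq.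
rewrite -{1}[size cs in X in (_ + X)%N]muln1.
rewrite -mulnDr addn1 => /(_ csB) /code_at_cat[].
rewrite (@size_compile_seq _ _ S) // size_map -szr => h1 h2.
have [tr [t1 t2 t3]] := run_compile_seq x csS' h1.
set k := find (fun c : expr R d * nat => 0 <= eval_expr c.1 x) cs.
have kcs : (k < size cs)%N by rewrite -has_find.
pose c0 : expr R d * nat := (EConst 0, 0%N).
exists k, (regs ++ tr); split => //.
- exact: (nth_find c0 hasc).
- by rewrite size_cat t1 size_map.
move=> F v hF.
apply: (@run_mono _ _ _ (size (map fst cs) * S + (k.+1 + F))).
  rewrite addnA leq_add2r size_map; apply: leq_trans csB.
  by rewrite mulnS addnC leq_add2r.
rewrite t3 size_map.
have hk i : (i < size cs)%N ->
    nth 0 (regs ++ tr) (size regs + i * S + S.-1) = eval_expr (nth c0 cs i).1 x.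
  by move=> ics; rewrite t2 ?size_map // (nth_map c0).
rewrite (run_branches _ _ h2 kcs) ?hk //.
- by rewrite (nth_map c0).
- exact: (nth_find c0 hasc).
- move=> i ik; rewrite hk ?(ltn_trans ik) // ltNge.
  by apply/negbT; apply: (before_find c0 ik).
Qed.

Section Layers.
Variables (M S B L : nat) (sz : nat -> nat) (croot : seq nat) (cand : nat -> nat -> seq nat)
  (tst : nat -> nat -> expr R d) (leaf : nat -> expr R d).
Hypotheses (MB : (M * S.+1 <= B)%N) (croot_size : size croot = M)
  (cand_size : forall l i, size (cand l i) = M) (tst_size : forall l i, esize (tst l i) = S)
  (leaf_size : forall i, (esize (leaf i) < B)%N).

Fixpoint offset (l : nat) : nat := if l is l'.+1 then offset l' + sz l' else 1.

Let decision (r l : nat) (js : seq nat) : node :=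
  (r, inl [seq (tst l j, (offset l + j)%N) | j <- js]).

Let layer_node (l i : nat) : node :=
  if (l < L)%N then decision (l.+1 * (M * S)) l.+1 (cand l i)
  else (l.+1 * (M * S), inr (leaf i))%N.

Fixpoint layers (l : nat) : seq node :=
  if l is l'.+1 then layers l' ++ mkseq (layer_node l') (sz l')
  else [:: decision 0 0 croot].

Let size_layers l : size (layers l) = offset l.
Proof. by elim: l => //= l IH; rewrite size_cat IH size_mkseq. Qed.

Let nth_layers m l i : (l < m)%N -> (i < sz l)%N ->
  (offset l + i < size (layers m))%N /\
  nth (0, inl [::]) (layers m) (offset l + i) = layer_node l i.
Proof.
move=> lm il; elim: m lm => // m IH; rewrite ltnS leq_eqVlt => /orP[/eqP <-|lm].
  rewrite /= size_cat size_layers size_mkseq ltn_add2l il nth_cat size_layers.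
  by rewrite ltnNge leq_addr /= addKn nth_mkseq.
have [h1 h2] := IH lm.
by rewrite /= size_cat nth_cat h1 h2 ltn_addr.
Qed.

Let nth_root m : (0 < size (layers m))%N /\
  nth (0, inl [::]) (layers m) 0 = decision 0 0 croot.
Proof. by elim: m => //= m [h1 h2]; rewrite size_cat nth_cat h1 h2 ltn_addr. Qed.

Let decision_ok l js : all (fun c : expr R d * nat => esize c.1 == S)
  [seq (tst l j, (offset l + j)%N) | j <- js].
Proof. by rewrite all_map; apply/allP => j _ /=; rewrite tst_size. Qed.

Let decision_step nds n r l js regs x : (n < size nds)%N ->
  nth (0, inl [::]) nds n = decision r l js -> size js = M -> size regs = r ->
  has (fun j => 0 <= eval_expr (tst l j) x) js ->
  let cs := [seq (tst l j, (offset l + j)%N) | j <- js] in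
  exists k regs', let c := nth (EConst 0, 0%N) cs k in
    [/\ (k < size cs)%N, 0 <= eval_expr c.1 x, size regs' = (r + size cs * S)%N &
    forall F v, run (assemble B S nds) F (c.2 * B) regs' x = Some v ->
      run (assemble B S nds) (B + F) (n * B) regs x = Some v].
Proof.
move=> h1 h2 jsM szr hjs; apply: (run_node h1 h2 (decision_ok _ _) _ szr).
  by rewrite size_map jsM.
by rewrite has_map.
Qed.

(** The [L.+2] blocks on a path are the root, one decision node in each layer below [L], and a
    leaf. *)
Lemma layered_program (A : set 'rV[R]_d) (val : 'rV[R]_d -> R -> Prop) :
  (forall x, A x -> has (fun j => 0 <= eval_expr (tst 0 j) x) croot /\
     forall j, j \in croot -> (j < sz 0)%N) ->
  (forall l i x, (l < L)%N -> (i < sz l)%N -> A x -> 0 <= eval_expr (tst l i) x ->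
     has (fun j => 0 <= eval_expr (tst l.+1 j) x) (cand l i) /\
     forall j, j \in cand l i -> (j < sz l.+1)%N) ->
  (forall i x, (i < sz L)%N -> A x -> 0 <= eval_expr (tst L i) x -> val x (eval_expr (leaf i) x)) ->
  exists prog, size prog = (offset L.+1 * B)%N /\
    forall x, A x -> exists v, query prog (L.+2 * B) x = Some v /\ val x v.
Proof.
move=> hroot hstep hleaf.
exists (assemble B S (layers L.+1)); split; first by rewrite size_mkseq size_layers.
move=> x Ax.
(* Invariant on arrival at node [i] of layer [l]: its own test has succeeded and [l.+1 * (M * S)]
   registers are in use. *)
have go m l i regs : (l + m = L)%N -> (i < sz l)%N -> 0 <= eval_expr (tst l i) x ->
    size regs = (l.+1 * (M * S))%N -> exists v, run (assemble B S (layers L.+1)) (m.+1 * B)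
      ((offset l + i) * B) regs x = Some v /\ val x v.
  elim: m l i regs => [|m IH] l i regs lm il ti szr.
    rewrite addn0 in lm; subst l.
    have [h1 h2] := nth_layers (ltnSn L) il.
    rewrite /layer_node ltnn in h2; exists (eval_expr (leaf i) x); rewrite mul1n.
    by split; [apply: run_leaf h1 h2 _ szr|exact: hleaf].
  have lL : (l < L)%N by lia.
  have [h1 h2] := nth_layers (leqW lL) il.
  rewrite /layer_node lL in h2.
  have [hs hr] := hstep l i x lL il Ax ti.
  have [k [regs' []]] := decision_step h1 h2 (cand_size l i) szr hs.
  rewrite size_map => kc; rewrite (nth_map 0%N) //= => tc szr' hF.
  set j := nth 0%N _ k in tc hF; have jin : j \in cand l i by exact: mem_nth.
  have lm' : (l.+1 + m = L)%N by lia.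
  have szr'' : size regs' = (l.+2 * (M * S))%N.
    by rewrite szr' cand_size [in RHS]mulSn addnC.
  have [v [hv1 hv2]] := IH _ _ _ lm' (hr j jin) tc szr''.
  by exists v; split => //; rewrite mulSn; exact: hF.
have [hs hr] := hroot x Ax.
have [h1 h2] := nth_root L.+1.
have [k [regs' []]] := decision_step h1 h2 croot_size (erefl 0%N : size [::] = 0%N) hs.
rewrite size_map => kc; rewrite (nth_map 0%N) //= => tc szr' hF.
set j := nth 0%N _ k in tc hF; have jin : j \in croot by exact: mem_nth.
have szr'' : size regs' = (1 * (M * S))%N by rewrite szr' croot_size mul1n.
have [v [hv1 hv2]] := go L 0%N j regs' (add0n L) (hr j jin) tc szr''.
by exists v; split => //; rewrite /query mulSn; exact: hF.
Qed.

End Layers.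

End Layered.

(** * The distance to the boundary of a polytope *)

Section Polytope.
Import numFieldNormedType.Exports.
Variables (R : realType) (d : nat) (V : seq 'rV[R]_d).
Implicit Types (x y z p q : 'rV[R]_d).
Local Notation Om := (polytope V).

Lemma polytope_convex t x y : 0 <= t -> t <= 1 -> Om x -> Om y -> Om (t *: x + (1 - t) *: y).
Proof.
move=> t0 t1 [w [w0 [w1 ->]]] [w' [w'0 [w'1 ->]]].
exists (fun i => t * w i + (1 - t) * w' i); split.
  by move=> i; rewrite addr_ge0 // mulr_ge0 // subr_ge0.
split; first by rewrite big_split /= -!mulr_sumr w1 w'1; ring.
rewrite !scaler_sumr -big_split /=; apply: eq_bigr => i _.
by rewrite !scalerA scalerDl.
Qed.

Lemma enorm_sum (I : Type) (r : seq I) (F : I -> 'rV[R]_d) :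
  enorm (\sum_(i <- r) F i) <= \sum_(i <- r) enorm (F i).
Proof.
elim: r => [|i r IH]; first by rewrite !big_nil enorm0.
by rewrite !big_cons; apply: le_trans (enormD _ _) _; rewrite lerD2l.
Qed.

Lemma polytope_bounded : exists B, forall x, Om x -> enorm x <= B.
Proof.
exists (\sum_(i < size V) enorm V`_i) => x [w [w0 [w1 ->]]].
apply: le_trans (enorm_sum _ _) _; apply: ler_sum => i _.
rewrite enormZ ger0_norm // ler_piMl ?enorm_ge0 // -w1 (bigD1 i) //= lerDl.
by apply: sumr_ge0.
Qed.

(** The polytope is the continuous image of the compact simplex of weights. *)
Lemma polytope_closed x : ~ Om x -> exists2 e, 0 < e & forall y, enorm (y - x) < e -> ~ Om y.
Proof.
pose n := size V.
pose phi (w : 'rV[R]_n) : 'rV[R]_d := \sum_(i < n) w ord0 i *: V`_i.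
pose K1 : set 'rV[R]_n := [set w | forall i, `[0, 1]%classic (w ord0 i)].
pose K2 : set 'rV[R]_n := [set w | \sum_(i < n) w ord0 i = 1].
have cK2 : closed K2.
  apply: (@preimage_closed _ _ (fun w : 'rV[R]_n => \sum_(i < n) w ord0 i) [set 1]).
    move=> w _; apply: continuous_big w; first exact: add_continuous.
    by move=> i _; exact: coord_continuous.
  exact: closed_eq.
have cK : compact (K1 `&` K2).
  apply: compact_closedI => //.
  by apply: (@rV_compact R n (fun=> `[0, 1]%classic)) => i; exact: segment_compact.
have OmE : Om = phi @` (K1 `&` K2).
  apply/seteqP; split=> [y [w [w0 [w1 ->]]]|y [w [Kw1 Kw2] <-]].
    exists (\row_i w i); last by apply: eq_bigr => i _; rewrite mxE.
    split; last by rewrite /K2 /=; under eq_bigr do rewrite mxE.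
    move=> i; rewrite /= in_itv /= mxE w0 -w1 (bigD1 i) //= lerDl.
    by apply: sumr_ge0.
  exists (fun i => w ord0 i); split=> [i|].
    by have := Kw1 i; rewrite /= in_itv => /andP[].
  by split.
have cphi : continuous phi.
  apply: continuous_big; first exact: add_continuous.
  by move=> i _ w; apply: (cvgZr_tmp (F := nbhs w)); exact: (@coord_continuous R 1 n ord0 i w).
have clOm : closed Om.
  rewrite OmE; apply: compact_closed; first exact: norm_hausdorff.
  by apply: continuous_compact cK; exact: continuous_subspaceT.
move=> nx; have : open (~` Om) by exact: closed_openC.
(* [ball] refers to the sup norm, which the Euclidean norm dominates. *)
rewrite openE => /(_ x nx) /nbhs_ballP[e /= e0 he]; exists e => // y yx.
apply: he; split => // i j.
rewrite /ball /= (ord1 i); apply: le_lt_trans yx.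
by have := coord_le_enorm (x - y) j; rewrite enormB !mxE.
Qed.

(** The point [b] is the last point of the polytope on the segment from [x] to [y]. *)
Lemma boundary_crossing x y : Om x -> ~ Om y ->
  exists2 b, boundary Om b & enorm (x - b) <= enorm (x - y).
Proof.
move=> Ox Oy; set l := enorm (y - x) + 1.
have l0 : 0 < l by rewrite ltr_wpDl ?enorm_ge0.
have lE a : enorm (a *: (y - x)) <= `|a| * l.
  by rewrite enormZ ler_wpM2l // lerDl.
pose S := [set t : R | 0 <= t <= 1 /\ Om (x + t *: (y - x))].
have S0 : S 0 by rewrite /S /= lexx ler01 scale0r addr0.
have hS : has_sup S by split; [exists 0|exists 1 => t [/andP[]]].
set s := sup S.
have s0 : 0 <= s by exact: sup_upper_bound.
have s1 : s <= 1 by apply: ge_sup; [exists 0|move=> t [/andP[]]].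
have Ob : Om (x + s *: (y - x)).
  apply: contrapT => /polytope_closed[e e0 he].
  have [t St ts] := sup_adherent (divr_gt0 e0 l0) hS.
  apply: (he _ _ St.2); rewrite opprD addrACA subrr add0r -scalerBl.
  apply: le_lt_trans (lE _) _; rewrite -ltr_pdivlMr //.
  have := sup_upper_bound hS St; rewrite -/s in ts * => ?.
  by rewrite ltr_norml; apply/andP; split; lra.
exists (x + s *: (y - x)).
  split => // -[r [r0 hr]].
  have s1' : s < 1.
    rewrite lt_neqAle s1 andbT; apply/eqP => sE; apply: Oy.
    by have := Ob; rewrite sE scale1r subrKC.
  (* A step beyond [s] that stays both on the segment and in the supposed interior ball contradicts
     the supremum. *)
  pose a := Num.min (1 - s) (r / (2 * l)).
  have a0 : 0 < a by rewrite lt_min subr_gt0 s1' divr_gt0 // mulr_gt0.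
  have a1 : a <= 1 - s by rewrite ge_min lexx.
  have a2 : a <= r / (2 * l) by rewrite ge_min lexx orbT.
  have : S (s + a).
    split; first by apply/andP; split; lra.
    apply: hr; rewrite opprD addrACA subrr add0r -scalerBl addrAC subrr add0r.
    apply: le_lt_trans (lE _) _; rewrite gtr0_norm // -ltr_pdivlMr //.
    apply: le_lt_trans a2 _; rewrite invfM mulrA ltr_pM2r ?invr_gt0 //; lra.
  by move/(sup_upper_bound hS); rewrite -/s; lra.
rewrite opprD addrA subrr add0r enormN enormZ ger0_norm // [leRHS]enormB.
by rewrite ler_piMl ?enorm_ge0.
Qed.

Hypothesis d0 : (0 < d)%N.
Hypothesis hint : exists x, interior_pts Om x.
Local Notation dist := (dist_boundary Om).

Lemma interior_sub x : interior_pts Om x -> Om x.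
Proof. by move=> [r [r0 hr]]; apply: hr; rewrite subrr enorm0. Qed.

Lemma boundary_nonempty : exists b, boundary Om b.
Proof.
have [x /interior_sub Ox] := hint; have [B hB] := polytope_bounded.
have [|b hb _] := @boundary_crossing x ((B + 1) *: delta_mx ord0 (Ordinal d0)) Ox.
  move/hB; have B0 : 0 <= B := le_trans (enorm_ge0 x) (hB x Ox).
  have := coord_le_enorm ((B + 1) *: (delta_mx ord0 (Ordinal d0) : 'rV[R]_d)) (Ordinal d0).
  rewrite !mxE !eqxx mulr1 ger0_norm; last by lra.
  by move=> h1 h2; have := le_trans h1 h2; lra.
by exists b.
Qed.

Lemma dist_has_inf x : has_inf [set r | exists y, boundary Om y /\ r = enorm (x - y)].
Proof.
have [b hb] := boundary_nonempty; split; first by exists (enorm (x - b)), b.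
by exists 0 => _ [y [_ ->]]; exact: enorm_ge0.
Qed.

Lemma dist_le x b : boundary Om b -> dist x <= enorm (x - b).
Proof. by move=> hb; apply: ge_inf; [exact: (dist_has_inf x).2|exists b]. Qed.

Lemma le_dist x r : (forall b, boundary Om b -> r <= enorm (x - b)) -> r <= dist x.
Proof.
by move=> h; apply: lb_le_inf; [exact: (dist_has_inf x).1|move=> _ [b [hb ->]]; exact: h].
Qed.

Lemma dist_ge0 x : 0 <= dist x.
Proof. by apply: le_dist => b _; exact: enorm_ge0. Qed.

Lemma dist_ball x y : Om x -> enorm (y - x) < dist x -> Om y.
Proof.
move=> Ox yx; apply: contrapT => /(boundary_crossing Ox)[b /(dist_le x) h1 h2].
by have := le_lt_trans (le_trans h1 h2) (_ : _ < dist x); rewrite enormB yx ltxx => /(_ isT).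
Qed.

Lemma ball_dist x r : (forall y, enorm (y - x) < r -> Om y) -> r <= dist x.
Proof.
move=> h; apply: le_dist => b [_ nb]; rewrite leNgt; apply/negP => br.
apply: nb; exists (r - enorm (x - b)); split; first by rewrite subr_gt0.
move=> y yb; apply: h.
have -> : y - x = (y - b) + (b - x) by rewrite addrA subrK.
apply: le_lt_trans (enormD _ _) _.
by rewrite (enormB b x); move: yb; rewrite ltrBrDr.
Qed.

(** A convex combination of inscribed balls is inscribed: the displacement [z - m] is split in
    proportion to the radii at [x] and [y]. *)
Lemma dist_concave t x y : 0 <= t -> t <= 1 -> Om x -> Om y ->
  t * dist x + (1 - t) * dist y <= dist (t *: x + (1 - t) *: y).
Proof.
move=> t0 t1 Ox Oy; apply: ball_dist => z; set m := t *: x + _; set s := t * dist x + _ => zs.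
have s0 : 0 < s := le_lt_trans (enorm_ge0 _) zs.
have near w : Om w -> Om (w + (dist w / s) *: (z - m)).
  move=> Ow; have [dw|dw] := eqVneq (dist w) 0.
    by rewrite dw mul0r scale0r addr0.
  have dw0 : 0 < dist w by rewrite lt_neqAle eq_sym dw dist_ge0.
  apply: (dist_ball Ow); rewrite [w + _]addrC addrK enormZ ger0_norm ?divr_ge0 ?ltW //.
  by rewrite mulrAC ltr_pdivrMr // ltr_pM2l.
have := polytope_convex t0 t1 (near x Ox) (near y Oy); congr (Om _).
have sE : t * (dist x / s) + (1 - t) * (dist y / s) = 1.
  by rewrite !mulrA -mulrDl divff // gt_eqF.
have lin (a b : R) (e : 'rV[R]_d) : t *: (x + a *: e) + (1 - t) *: (y + b *: e) =
    m + (t * a + (1 - t) * b) *: e.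
  by apply/rowP => i; rewrite !mxE; ring.
by rewrite lin sE scale1r subrKC.
Qed.

Lemma dist_lip x y : dist x <= dist y + enorm (x - y).
Proof.
rewrite -lerBlDr; apply: le_dist => b hb; rewrite lerBlDr.
apply: le_trans (dist_le x hb) _; rewrite [leRHS]addrC.
have -> : x - b = (x - y) + (y - b) by rewrite addrA subrK.
exact: enormD.
Qed.

(* Infimal convolution with the norm extends - dist to a convex function on the whole space. *)
Lemma dist_extension : exists F : 'rV[R]_d -> R,
  [/\ convexf F, forall x y, `|F x - F y| <= enorm (x - y) &
      forall x, Om x -> F x = - dist x].
Proof.
pose J x (a : R) := exists2 w, Om w & enorm (x - w) - dist w <= a.
have [x0 /interior_sub Ox0] := hint.
have J0 x : exists a, J x a by exists (enorm (x - x0) - dist x0), x0.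
(* [- dist] is 1-Lipschitz on the whole space, so it bounds the convolution from below; on [Om] the
   choice [w = x] attains it. *)
have Jlb x : lbound [set a | J x a] (- dist x).
  by move=> a [w _]; apply: le_trans; have := dist_lip w x; rewrite enormB; lra.
exists (fun x => inf [set a | J x a]).
have FJ x a : J x a -> inf [set a | J x a] <= a.
  by move=> h; apply: ge_inf => //; exists (- dist x).
have JF x r : (forall a, J x a -> r <= a) -> r <= inf [set a | J x a].
  by move=> h; apply: lb_le_inf => //; have [a] := J0 x; exists a.
have lip x y : inf [set a | J x a] <= inf [set a | J y a] + enorm (x - y).
  rewrite -lerBlDr; apply: JF => a [w Ow hw]; rewrite lerBlDr.
  apply: FJ; exists w => //.
  have : enorm (x - w) <= enorm (x - y) + enorm (y - w).
    by have -> : x - w = (x - y) + (y - w); [rewrite addrA subrK|exact: enormD].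
  lra.
split.
- apply: convexf_inf => // [x|t x y a b t0 t1 [w Ow hw] [w' Ow' hw']].
    by exists (- dist x).
  exists (t *: w + (1 - t) *: w'); first exact: polytope_convex.
  have t1' : 0 <= 1 - t by rewrite subr_ge0.
  have -> : t *: x + (1 - t) *: y - (t *: w + (1 - t) *: w') =
    t *: (x - w) + (1 - t) *: (y - w') by rewrite !scalerBr opprD addrACA.
  have := enormD (t *: (x - w)) ((1 - t) *: (y - w')).
  rewrite !enormZ !ger0_norm //.
  have := dist_concave t0 t1 Ow Ow'.
  have := ler_wpM2l t0 hw; have := ler_wpM2l t1' hw'; lra.
- move=> x y; rewrite ler_norml; apply/andP; split.
    by have := lip y x; rewrite enormB; lra.
  by have := lip x y; lra.
- move=> x Ox; apply/eqP; rewrite eq_le; apply/andP; split; last by apply: JF => a; exact: Jlb.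
  by apply: FJ; exists x => //; rewrite subrr enorm0 sub0r.
Qed.

Lemma diam_ub x y : Om x -> Om y -> enorm (x - y) <= diam Om.
Proof.
move=> Ox Oy; have [B hB] := polytope_bounded; apply: ub_le_sup; last by exists x, y.
exists (B + B) => _ [a [b [Oa [Ob ->]]]].
by apply: le_trans (enormD _ _) _; rewrite enormN lerD ?hB.
Qed.

Lemma diam_gt0 : 0 < diam Om.
Proof.
have [x Ix] := hint; have Ox := interior_sub Ix; have [r [r0 hr]] := Ix.
have := @diam_ub (x + (r / 2) *: delta_mx ord0 (Ordinal d0)) x.
rewrite [x + _]addrC addrK => h.
have r2 : 0 < r / 2 by rewrite divr_gt0.
rewrite enormZ enorm_delta mulr1 gtr0_norm // in h.
apply: lt_le_trans (h _ Ox) => //.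
by apply: hr; rewrite addrK enormZ enorm_delta mulr1 gtr0_norm //; lra.
Qed.

End Polytope.

(** * Cell tests and affine leaves as arithmetic expressions *)

Section Tests.
Variables (R : realType) (d : nat).
Implicit Types (e : expr R d) (a c : R) (x u y p : 'rV[R]_d) (T : 'M[R]_d).

Definition esum (es : seq (expr R d)) : expr R d := foldr (@EAdd R d) (EConst 0) es.

Lemma eval_esum (I : Type) (r : seq I) (F : I -> expr R d) x :
  eval_expr (esum [seq F i | i <- r]) x = \sum_(i <- r) eval_expr (F i) x.
Proof. by elim: r => [|i r IH]; rewrite ?big_nil // big_cons -IH. Qed.

Lemma esize_esum (I : Type) (r : seq I) (F : I -> expr R d) n :
  (forall i, esize (F i) = n) -> esize (esum [seq F i | i <- r]) = (size r * n.+1).+1.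
Proof. by move=> Fn; elim: r => //= i r ->; rewrite Fn; lia. Qed.

Section Frame.
Variables (x0 : 'rV[R]_d) (D : R).

Let unscale x : 'rV[R]_d := D^-1 *: (x - x0).

Definition input_minus y (i : 'I_d) : expr R d :=
  EAdd (EConst (- y ord0 i)) (EMul (EConst D^-1) (EAdd (EConst (- x0 ord0 i)) (EInput i))).

Lemma eval_input_minus y i x : eval_expr (input_minus y i) x = (unscale x - y) ord0 i.
Proof. by rewrite /= !mxE; ring. Qed.

Definition coord_expr T y (k : 'I_d) : expr R d :=
  esum [seq EMul (input_minus y i) (EConst (T i k)) | i <- enum 'I_d].

Lemma eval_coord_expr T y k x : eval_expr (coord_expr T y k) x = ((unscale x - y) *m T) ord0 k.
Proof.
rewrite eval_esum big_enum [RHS]mxE; apply: eq_bigr => i _.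
by rewrite -eval_input_minus.
Qed.

Definition cell_test T y : expr R d :=
  EAdd (EConst (4 * d%:R ^+ 2)^-1)
    (EMul (EConst (-1)) (esum [seq EMul (coord_expr T y k) (coord_expr T y k) | k <- enum 'I_d])).

Lemma eval_cell_test T y x : (0 <= eval_expr (cell_test T y) x) = in_cell T y (unscale x).
Proof.
rewrite /= eval_esum big_enum /= mulN1r subr_ge0 /in_cell; congr (_ <= _).
by apply: eq_bigr => k _; rewrite /= eval_coord_expr expr2.
Qed.

Definition test_size : nat := (d * (2 * (d * 10).+1).+2 + 5)%N.

Lemma esize_cell_test T y : esize (cell_test T y) = test_size.
Proof.
rewrite /cell_test /= (@esize_esum _ _ _ (2 * (d * 10).+1).+1) => [|k].
  by rewrite size_enum_ord /test_size; lia.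
by rewrite /= (@esize_esum _ _ _ 9) // size_enum_ord; lia.
Qed.

Definition affine_expr (c a : R) p y : expr R d :=
  EMul (EConst c) (EAdd (EConst a)
    (esum [seq EMul (EConst (p ord0 i)) (input_minus y i) | i <- enum 'I_d])).

Lemma eval_affine_expr c a p y x :
  eval_expr (affine_expr c a p y) x = c * (a + dot p (unscale x - y)).
Proof.
rewrite /= eval_esum big_enum; congr (_ * (_ + _)); apply: eq_bigr => i _.
by rewrite -eval_input_minus.
Qed.

Lemma esize_affine_expr c a p y : (esize (affine_expr c a p y) < d * 10 + 6)%N.
Proof. by rewrite /= (@esize_esum _ _ _ 9) // size_enum_ord; lia. Qed.

End Frame.
End Tests.

(** Repeating the head gives every decision node exactly [M] tests, which keeps the register count
    independent of the path. *)
Definition pad (M : nat) (js : seq nat) : seq nat := mkseq (nth (head 0%N js) js) M.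

Lemma mem_pad M js j : (size js <= M)%N -> j \in js -> j \in pad M js.
Proof.
move=> jsM jin; apply/mapP; exists (index j js); last by rewrite nth_index.
by rewrite mem_iota /= add0n (leq_trans _ jsM) // index_mem.
Qed.

Lemma pad_mem M js j i : i \in js -> j \in pad M js -> j \in js.
Proof.
case: js => // a js _ /mapP[k _ ->].
case: (ltnP k (size (a :: js))) => h; first exact: mem_nth.
by rewrite nth_default //= mem_head.
Qed.

(** * The search program for a convex Lipschitz function *)

Section Program.
Variables (R : realType) (d : nat) (d0 : (0 < d)%N).
Local Notation D := (d%:R : R).

(** The bound of [separated_size] at scale 1: the root tests the whole coarsest net. *)
Definition rootM : nat := (clusterM R d * (Num.truncn (2 * 4 / (1 / (64 * D ^+ 3)))).+1 ^ d)%N.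
Definition branching : nat := (childM R d + rootM)%N.
Definition block_size : nat := (branching * (test_size d).+1 + (d * 10 + 6))%N.
Definition netC : R := (clusterM R d)%:R * (512 * D ^+ 3 + 1) ^+ d.

Lemma netC_ge0 : 0 <= netC.
Proof.
rewrite /netC; apply: mulr_ge0; first exact: ler0n.
by apply: exprn_ge0; have := exprn_ge0 3 (ler0n R d); lra.
Qed.

Lemma approx_program (f : 'rV[R]_d -> R) (L : nat) (x0 : 'rV[R]_d) (D0 c : R) : 0 < D0 ->
  convexf f -> (forall x y, `|f x - f y| <= enorm (x - y)) ->
  exists (prog : seq (instr R d)) (N : nat),
    [/\ size prog = (N * block_size)%N, N%:R <= 1 + 2 * netC * (2 ^+ d) ^+ L &
    forall x, enorm (x - x0) <= D0 -> exists v, query prog (L.+2 * block_size) x = Some v /\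
      `|v - c * f (D0^-1 *: (x - x0))| <= `|c| * ((2 ^- L) ^+ 2)].
Proof.
move=> D0gt0 cf lipf.
pose s l : R := 2 ^- l.
have s0 l : 0 < s l by rewrite /s invr_gt0 exprn_gt0.
have s1 l : s l <= 1 by rewrite /s invf_le1 ?exprn_gt0 // exprn_ege1 // ler1n.
have sS l : s l.+1 = s l / 2 by rewrite /s exprS invfM mulrC.
have [X hX] := choice (fun l => net_exists d0 cf lipf (s0 l) (s1 l)).
have [T0 hT0] := choice (fun lx : nat * 'rV[R]_d =>
  frame_exists d0 cf lipf lx.2 (s0 lx.1) (s1 lx.1)).
pose T l x := T0 (l, x).
have hT l x : frame (addsq f) (s l ^+ 2) x (T l x) := hT0 (l, x).
have [P hP] := choice (fun x => affine_on_cell d0 cf (hT L x)).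
pose u x : 'rV[R]_d := D0^-1 *: (x - x0).
pose A : set 'rV[R]_d := [set x | enorm (x - x0) <= D0].
have u1 x : A x -> enorm (u x) <= 1.
  by move=> Ax; rewrite enormZ gtr0_norm ?invr_gt0 // mulrC ler_pdivrMr // mul1r.
pose sz l := size (X l).
pose cell l j := in_cell (T l (X l)`_j) (X l)`_j.
pose tst l j := cell_test x0 D0 (T l (X l)`_j) (X l)`_j.
have tstE l j x : (0 <= eval_expr (tst l j) x) = cell l j (u x) by rewrite eval_cell_test.
have cover l y : enorm y <= 1 -> exists2 j, (j < sz l)%N & cell l j y.
  move=> y1; have [_ _ /(_ y y1) [j jX h]] := hX l.
  by exists j => //; exact: (in_cell_cover d0 (hT l (X l)`_j) h).
pose leaf j := affine_expr x0 D0 c (f (X L)`_j) (P (X L)`_j) (X L)`_j.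
(* Linking the cells that meet is enough: the query point lies in the current cell and, by [cover],
   in some cell of the next net. *)
pose ch l i : {set 'I_(sz l.+1)} :=
  finset (fun j : 'I_(sz l.+1) => `[< exists y, cell l i y /\ cell l.+1 j y >]).
have chM l i : (#|ch l i| <= childM R d)%N.
  apply: (children_le d0 cf (hT l (X l)`_i) (TX := fun j => T l.+1 (X l.+1)`_j)).
  - by rewrite -sS; have [] := hX l.+1.
  - by move=> j; rewrite -sS.
  - by move=> j; rewrite inE => /asboolP.
pose chs l i : seq nat := map val (enum (ch l i)).
have szchs l i : (size (chs l i) <= branching)%N.
  by rewrite size_map -cardE (leq_trans (chM l i)) // leq_addr.
have chs_lt l i j : j \in chs l i -> (j < sz l.+1)%N by case/mapP => k _ ->; exact: ltn_ord.
pose cand l i := pad branching (chs l i).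
pose croot := pad branching (iota 0 (sz 0)).
have szroot : (size (iota 0 (sz 0)) <= branching)%N.
  rewrite size_iota; have [X1 sX _] := hX 0%N.
  have := separated_size d0 cf lipf (s0 0%N) (s1 0%N) X1 sX.
  by rewrite /s expr0 invr1 => /leq_trans; apply; rewrite leq_addl.
have [||||||||prog [szprog hprog]] := @layered_program R d branching (test_size d) block_size L sz
  croot cand tst leaf _ _ _ _ _ A (fun x v => `|v - c * f (u x)| <= `|c| * (2 ^- L) ^+ 2).
- exact: leq_addr.
- exact: size_mkseq.
- by move=> l i; exact: size_mkseq.
- by move=> l i; exact: esize_cell_test.
- by move=> i; apply: leq_trans (esize_affine_expr _ _ _ _ _ _) _; exact: leq_addl.
- move=> x Ax; have [j jl cj] := cover 0%N (u x) (u1 x Ax).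
  have jin : j \in iota 0 (sz 0) by rewrite mem_iota.
  split; first by apply/hasP; exists j; rewrite ?tstE //; exact: mem_pad.
  by move=> i /(pad_mem jin); rewrite mem_iota.
- move=> l i x lL il Ax; rewrite tstE => ci.
  have [j jl cj] := cover l.+1 (u x) (u1 x Ax).
  have jin : j \in chs l i.
    apply/mapP; exists (Ordinal jl) => //; rewrite mem_enum inE; apply/asboolP.
    by exists (u x).
  split; first by apply/hasP; exists j; rewrite ?tstE //; exact: mem_pad.
  by move=> k /(pad_mem jin) /chs_lt.
- move=> i x il Ax; rewrite tstE => ci; rewrite eval_affine_expr -mulrBr normrM.
  by rewrite ler_wpM2l //; exact: hP.
exists prog, (offset sz L.+1); split => //.
have netC0 := netC_ge0.
have szX l : (sz l)%:R <= netC * (2 ^+ d) ^+ l.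
  have [X1 sX _] := hX l.
  have := separated_size_real d0 cf lipf (s0 l) (s1 l) X1 sX.
  by rewrite /s exprVn invrK -!exprM mulnC.
(* With ratio at least 2, the bounds on the layers sum to at most twice the last one. *)
have q2 : (2 : R) <= 2 ^+ d by rewrite -[leLHS]expr1 ler_weXn2l // ler1n.
elim: (L) => [|l IH].
  rewrite [offset _ _]/= natrD; have := szX 0%N; rewrite expr0; lra.
have -> : (offset sz l.+2)%:R = (offset sz l.+1)%:R + (sz l.+1)%:R :> R by rewrite -natrD.
have h1 := szX l.+1; rewrite exprS in h1 *.
have h2 : netC * (2 * (2 ^+ d) ^+ l) <= netC * (2 ^+ d * (2 ^+ d) ^+ l).
  by rewrite ler_wpM2l // ler_wpM2r // exprn_ge0 // exprn_ge0.
lra.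
Qed.

End Program.

(** * Choice of the depth and the final bounds *)

Lemma dyadic_depth (R : realType) (eps : R) : 0 < eps -> eps <= 1 / 2 ->
  exists L : nat, [/\ (2 ^- L) ^+ 2 <= eps, 2 ^+ L <= 2 * eps `^ (- 2^-1) &
    L.+2%:R * ln 2 <= 4 * ln (1 / eps)].
Proof.
move=> e0 e2.
have exL : exists n, (2 ^- n) ^+ 2 <= eps.
  have [n hn] : exists n : nat, eps^-1 < 2 ^+ n.
    exists (Num.truncn eps^-1).+1.
    apply: lt_trans (truncnS_gt _) _; rewrite -natrX ltr_nat.
    exact: ltn_expl.
  exists n; rewrite exprVn.
  have h1 : (1 : R) <= 2 ^+ n by rewrite exprn_ege1 // ler1n.
  rewrite -[leRHS]invrK lef_pV2 ?posrE ?invr_gt0 ?exprn_gt0 //.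
  by apply: le_trans (ltW hn) _; rewrite ler_eXnr.
(* The least depth is taken: [eps <= 1 / 2] rules out 0, and failure at the preceding depth [m]
   bounds [2 ^+ m] from above. *)
case: (ex_minnP exL) => -[|m] hm hmin.
  by move: hm; rewrite expr0 invr1 expr1n; lra.
have hm1 : eps < (2 ^- m) ^+ 2.
  by rewrite ltNge; apply/negP => /hmin; rewrite ltnn.
have e1 : (2 ^+ m) ^+ 2 < eps^-1.
  rewrite -[ltLHS]invrK ltf_pV2 ?posrE ?invr_gt0 ?exprn_gt0 //.
  by move: hm1; rewrite exprVn.
exists m.+1; split => //.
- rewrite exprS ler_pM2l // -(@ler_pXn2r _ 2) ?nnegrE ?exprn_ge0 ?powR_ge0 //.
  have -> : (eps `^ (- 2^-1)) ^+ 2 = eps^-1; last exact: ltW.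
  by rewrite -powR_mulrn ?powR_ge0 // -powRrM mulNr mulVf // powR_inv1 // ltW.
- have ln2 : 0 < ln 2 :> R by rewrite ln_gt0 // ltr1n.
  (* This pays for the additive 3 in [m.+3]. *)
  have h1 : ln 2 <= ln (1 / eps).
    rewrite ler_ln ?posrE ?divr_gt0 // ler_pdivlMr //; lra.
  have h2 : (2 * m)%:R * ln 2 <= ln (1 / eps).
    rewrite mulr_natl -lnXn // ler_ln ?posrE ?exprn_gt0 ?divr_gt0 //.
    by rewrite div1r mulnC exprM ltW.
  move: h2; rewrite natrM -[m.+3]addn3 natrD; nra.
Qed.

Theorem theorem7 (R : realType) (d : nat) : (1 <= d)%N ->
  exists C : R, 0 < C /\
  forall (V : seq 'rV[R]_d) (eps : R),
    (exists x, interior_pts (polytope V) x) ->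
    0 < eps -> eps <= 1 / 2 ->
    exists (prog : seq (instr R d)) (T : nat),
      (size prog)%:R <= C * eps `^ (- ((d%:R : R) / 2)) /\
      T%:R <= C * ln (1 / eps) /\
      forall x, polytope V x ->
        exists v, query prog T x = Some v /\
          `| v - dist_boundary (polytope V) x | <= eps * diam (polytope V).
Proof.
move=> d0; pose B : R := (block_size R d)%:R.
have B0 : 0 <= B by exact: ler0n.
have nC0 : 0 <= netC R d := netC_ge0 R d.
have ln2 : 0 < ln 2 :> R by rewrite ln_gt0 // ltr1n.
have C10 : 0 <= (1 + 2 * netC R d) * 2 ^+ d * B by rewrite !mulr_ge0 ?exprn_ge0 //; lra.
have C20 : 0 <= 4 / ln 2 * B by rewrite mulr_ge0 // divr_ge0 // ltW.
(* The storage and time constants are added; the last 1 makes the sum positive. *)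
exists ((1 + 2 * netC R d) * 2 ^+ d * B + 4 / ln 2 * B + 1); split; first by lra.
move=> V eps hint e0 e2.
have [L [L1 L2 L3]] := dyadic_depth e0 e2.
have [F [cF lF FE]] := dist_extension d0 hint.
have [x0 /interior_sub Ox0] := hint.
set D := diam (polytope V); have D0 : 0 < D := diam_gt0 d0 hint.
(* Rescaling by the diameter about a point of the polytope keeps [F] convex and 1-Lipschitz and
   brings the polytope into the unit ball. *)
pose f u := F (x0 + D *: u) / D.
have cf : convexf f.
  move=> t u w t0 t1; rewrite /f !mulrA -mulrDl ler_pM2r ?invr_gt0 //.
  apply: le_trans (cF t (x0 + D *: u) (x0 + D *: w) t0 t1); rewrite le_eqVlt; apply/orP; left.
  by apply/eqP; congr F; apply/rowP => i; rewrite !mxE; ring.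
have lf u w : `|f u - f w| <= enorm (u - w).
  rewrite /f -mulrBl normrM normfV (gtr0_norm D0) ler_pdivrMr //.
  apply: le_trans (lF _ _) _; rewrite opprD addrACA subrr add0r -scalerBr enormZ gtr0_norm //.
  by rewrite mulrC.
(* The factor [- D] undoes both the scaling and the sign of [F]. *)
have [prog [N [szp hN hq]]] := approx_program d0 L x0 (- D) D0 cf lf.
have lnp : 0 <= ln (1 / eps) by rewrite ln_ge0 // ler_pdivlMr //; lra.
have pw0 : 0 <= eps `^ (- (d%:R / 2)) by exact: powR_ge0.
exists prog, (L.+2 * block_size R d)%N; split; [|split].
(* The storage exponent arises here: [2 ^+ L] is of order [1 / sqrt eps] and is raised to the power
   [d]. *)
- have h : (2 ^+ d) ^+ L <= 2 ^+ d * eps `^ (- (d%:R / 2)).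
    rewrite -exprM mulnC exprM.
    have -> : eps `^ (- (d%:R / 2)) = (eps `^ (- 2^-1)) ^+ d.
      by rewrite -powR_mulrn ?powR_ge0 // -powRrM; congr (_ `^ _); rewrite mulNr mulrC.
    by rewrite -exprMn; apply: lerXn2r; rewrite ?nnegrE ?exprn_ge0 ?mulr_ge0 ?powR_ge0.
  have q1 : (1 : R) <= (2 ^+ d) ^+ L by rewrite exprn_ege1 // exprn_ege1 // ler1n.
  have hN' : N%:R <= (1 + 2 * netC R d) * (2 ^+ d * eps `^ (- (d%:R / 2))).
    apply: le_trans hN _; apply: le_trans (_ : (1 + 2 * netC R d) * (2 ^+ d) ^+ L <= _).
      by rewrite [leRHS]mulrDl mul1r lerD2r.
    by rewrite ler_wpM2l //; lra.
  rewrite szp natrM -/B; apply: le_trans (ler_wpM2r B0 hN') _.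
  have -> : (1 + 2 * netC R d) * (2 ^+ d * eps `^ (- (d%:R / 2))) * B =
    (1 + 2 * netC R d) * 2 ^+ d * B * eps `^ (- (d%:R / 2)) by ring.
  by rewrite ler_wpM2r //; lra.
- rewrite natrM -/B; have hL : L.+2%:R <= 4 / ln 2 * ln (1 / eps).
    by rewrite mulrAC ler_pdivlMr.
  apply: le_trans (ler_wpM2r B0 hL) _; rewrite mulrAC ler_wpM2r //; lra.
move=> x Ox; have [v [v1 v2]] := hq x (diam_ub Ox Ox0).
exists v; split => //; move: v2; rewrite /f scalerA divff ?gt_eqF // scale1r subrKC FE //.
rewrite normrN (gtr0_norm D0) => v2.
have -> : v - dist_boundary (polytope V) x = v - - D * (- dist_boundary (polytope V) x / D).
  by field; rewrite gt_eqF.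
by apply: le_trans v2 _; rewrite mulrC ler_wpM2r // ltW.
Qed.
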